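(* Consider the problem $\min_{\mathbf x\in\mathbb R^n}J(\mathbf x)$ subject to $\mathbf g(\mathbf x)\le\mathbf 0$, $\mathbf h(\mathbf x)=\mathbf 0$, with $J:\mathbb R^n\to\mathbb R$, $\mathbf g:\mathbb R^n\to\mathbb R^p$, $\mathbf h:\mathbb R^n\to\mathbb R^q$ of class $\mathcal C^2$, and assume the problem has a finite optimal value. Fix $\varepsilon>0$, let $\mathbf S$ be the smoothed stationarity vector defined in the context, $V=\tfrac12\|\mathbf S\|^2$, and $\mathcal S=\{\mathbf z:\mathbf S(\mathbf z)=\mathbf 0\}$. Let $(\mathbf x^\star,\boldsymbol\lambda^\star,\boldsymbol\mu^\star)$ be a KKT point at which LICQ holds. Suppose $\mathcal U\subseteq\mathbb R^{n+p+q}$ is an open neighborhood of $(\mathbf x^\star,\boldsymbol\lambda^\star,\boldsymbol\mu^\star)$ such that (a) (OLF regularity) $\nabla V(\mathbf z)\ne\mathbf 0$ for all $\mathbf z\in\mathcal U$ with $V(\mathbf z)\neq0$; (b) (Łojasiewicz inequality) there exist a neighborhood $\mathcal N\subseteq\mathcal U$ of $\mathcal S\cap\mathcal U$ and constants $c_{\mathrm L}>0$, $\alpha\in[0,1)$ with $\|\nabla V(\mathbf z)\|\ge c_{\mathrm L}V(\mathbf z)^\alpha$ for all $\mathbf z\in\mathcal N$; (c) $\mathcal S\cap\mathcal U=\{\mathbf z^\star_\varepsilon\}$ is a single point. Let $\sigma$ be any of the decay laws in the context, and let $\Omega_c=\{\mathbf z\in\mathcal U:V(\mathbf z)\le c\}$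 with $0<c\le\rho^\ast$, where $\rho^\ast>0$ is a threshold (which exists under these assumptions) such that for every $c'\in(0,\rho^\ast]$ the set $\Omega_{c'}$ is closed in $\mathcal U$ and forward invariant under the dynamics below. Then for every $\mathbf z(0)\in\Omega_c$, the trajectory $\mathbf z(t)$ of $$\dot{\mathbf z}=-\frac{\nabla\mathbf S(\mathbf z)^\top\mathbf S(\mathbf z)}{\|\nabla\mathbf S(\mathbf z)^\top\mathbf S(\mathbf z)\|^2}\,\sigma(V(\mathbf z),t)$$ satisfies $\mathbf z(t)\in\Omega_c$ for all $t\ge0$ (all $t\in[0,T)$ for the (PT) law), and the KKT conditions are enforced up to the smoothing tolerance $\varepsilon$ with the convergence law $\sigma$; that is, $\frac{d}{dt}V(\mathbf z(t))=-\sigma(V(\mathbf z(t)),t)$ while $V>0$, and $\mathbf S(\mathbf z(t))\to\mathbf 0$ with the timing of $\sigma$.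
   Context: Write $\mathbf z=\mathrm{col}(\mathbf x,\boldsymbol\lambda,\boldsymbol\mu)\in\mathbb R^{n+p+q}$. For $\varepsilon>0$ let $\phi_\varepsilon(a,b)=\sqrt{a^2+b^2+\varepsilon^2}-(a+b)$ (smoothed Fischer–Burmeister function; $\boldsymbol\phi_\varepsilon$ is its componentwise application) and $\widetilde\lambda_i=\tfrac12\big(\sqrt{\lambda_i^2+\varepsilon^2}+\lambda_i\big)$, $\widetilde{\boldsymbol\lambda}=\mathrm{col}(\widetilde\lambda_1,\dots,\widetilde\lambda_p)$. The smoothed stationarity vector is $$\mathbf S(\mathbf z)=\mathrm{col}\Big(\nabla J(\mathbf x)+\nabla\mathbf g(\mathbf x)^\top\widetilde{\boldsymbol\lambda}+\nabla\mathbf h(\mathbf x)^\top\boldsymbol\mu,\ \boldsymbol\phi_\varepsilon(\boldsymbol\lambda,-\mathbf g(\mathbf x)),\ \mathbf h(\mathbf x)\Big),$$ where $\nabla\mathbf g,\nabla\mathbf h,\nabla\mathbf S$ denote Jacobians; $\nabla V=\nabla\mathbf S^\top\mathbf S$. ''KKT conditions up to the smoothing tolerance $\varepsilon$'' means $\mathbf S=\mathbf 0$. KKT point: $\nabla J(\mathbf x^\star)+\nabla\mathbf g(\mathbf x^\star)^\top\boldsymbol\lambda^\star+\nabla\mathbf h(\mathbf x^\star)^\top\boldsymbol\mu^\star=\mathbf 0$; $\mathbf g(\mathbf x^\star)\le\mathbf 0$, $\boldsymbol\lambda^\star\ge\mathbf 0$, $\langle\boldsymbol\lambda^\star,\mathbf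 g(\mathbf x^\star)\rangle=0$; $\mathbf h(\mathbf x^\star)=\mathbf 0$. LICQ at $\mathbf x$: the gradients $\nabla h_j(\mathbf x)$, $j=1,\dots,q$, together with $\nabla g_i(\mathbf x)$ for all $i$ with $g_i(\mathbf x)=0$, are linearly independent. Forward invariant: every trajectory starting in the set stays in it for all future (admissible) times. The feedback is defined by the formula where $\mathbf S(\mathbf z)\ne\mathbf 0$; points of $\mathcal S$ are treated as equilibria (right-hand side $\mathbf 0$). Decay laws and their timing (positive constants $a,b,c_0,k,\mu,T$; $V_0=V(\mathbf z(0))$): (Exp) $\sigma=c_0V$, giving $V(\mathbf z(t))\le V_0e^{-c_0t}$; (FT) $\sigma=kV^\gamma$, $0<\gamma<1$, giving $V=0$ from some time at most $V_0^{1-\gamma}/[k(1-\gamma)]$ on; (FxT) $\sigma=aV^\gamma+bV^\delta$, $0<\gamma<1<\delta$, giving $V=0$ from some time at most $1/[a(1-\gamma)]+1/[b(\delta-1)]$ on; (PT) $\sigma=\frac{\mu}{T-t}V$, $t\in[0,T)$, giving $V(\mathbf z(t))\to0$ as $t\to T$.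
   Formalization: The threshold ρ* is taken as given with its closedness and forward invariance (trajectories exist and stay for all admissible times); that such a ρ* always exists is not asserted, as it can fail, e.g. when U has a zero of S on its boundary. *)

(* Defs.v *)
(* Built on MathComp and MathComp-Analysis. *)
From HB Require Import structures.
From mathcomp Require Export all_boot all_order all_algebra.
From mathcomp Require Export all_classical all_reals all_analysis.

Set Implicit Arguments.
Unset Strict Implicit.
Unset Printing Implicit Defensive.
Export Order.TTheory GRing.Theory Num.Theory.
Export numFieldNormedType.Exports.
#[export] Set Implicit Arguments.
#[export] Unset Strict Implicit.
#[export] Unset Printing Implicit Defensive.

Local Open Scope classical_set_scope.
Local Open Scope ring_scope.

(* Vectors are rows, and the library Jacobian acts on rows from the right:
   'J f x : 'M_(n, m) is the transpose of the textbook m x n Jacobian of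
   f : R^n -> R^m.  A textbook product  (Jacobian of f at x)^T w  is therefore
   the row  w *m ('J f x)^T. *)

Section Calculus.
Context {R : realType}.

Definition dotv n (u v : 'rV[R]_n) : R := \sum_i u 0 i * v 0 i.

(* Euclidean norm; the library norm `|u| on rows is the sup norm. *)
Definition norm2 n (u : 'rV[R]_n) : R := Num.sqrt (dotv u u).

Definition grad n (f : 'rV[R]_n -> R) (x : 'rV[R]_n) : 'rV[R]_n :=
  \row_i 'D_(delta_mx 0 i) f x.

(* In finite dimension, continuity (resp. class C^k) of the derivative is that
   of all the maps x |-> Df(x)v. *)
Fixpoint class_C (k : nat) (V W : normedModType R) (f : V -> W) : Prop :=
  if k is k'.+1 then
    (forall x, differentiable f x) /\ (forall v, class_C k' ('D_v f))
  else continuous f.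

Definition right_derivative (W : normedModType R) (f : R -> W) (t : R) (v : W) :=
  h^-1 *: (f (t + h) - f t) @[h --> 0^'+] --> v.

End Calculus.

Section ConstrainedProblem.
Context {R : realType} {n p q : nat}.
Variables (J : 'rV[R]_n -> R) (g : 'rV[R]_n -> 'rV[R]_p) (h : 'rV[R]_n -> 'rV[R]_q).

Definition feasible : set 'rV[R]_n :=
  [set x | (forall i, g x 0 i <= 0) /\ h x = 0].

Definition finite_optimal_value : Prop :=
  ereal_inf [set (J x)%:E | x in feasible] \is a fin_num.

Definition KKT_point (x : 'rV[R]_n) (lam : 'rV[R]_p) (mu : 'rV[R]_q) : Prop :=
  [/\ grad J x + lam *m ('J g x)^T + mu *m ('J h x)^T = 0,
      forall i, g x 0 i <= 0,
      forall i, 0 <= lam 0 i,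
      dotv lam (g x) = 0
    & h x = 0].

Definition LICQ (x : 'rV[R]_n) : Prop :=
  free ([seq grad (fun y => h y 0 j) x | j <- enum 'I_q]
        ++ [seq grad (fun y => g y 0 i) x | i <- enum 'I_p & g x 0 i == 0]).

Definition smoothed_FB (eps a b : R) : R :=
  Num.sqrt (a ^+ 2 + b ^+ 2 + eps ^+ 2) - (a + b).

Definition smoothed_multiplier (eps l : R) : R :=
  2^-1 * (Num.sqrt (l ^+ 2 + eps ^+ 2) + l).

Definition stationarity (eps : R) (z : 'rV[R]_(n + p + q)) : 'rV[R]_(n + p + q) :=
  let x := lsubmx (lsubmx z) in
  let lam := rsubmx (lsubmx z) in
  let mu := rsubmx z in
  row_mx
    (row_mx
      (grad J x + map_mx (smoothed_multiplier eps) lam *m ('J g x)^T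
                + mu *m ('J h x)^T)
      (map2_mx (smoothed_FB eps) lam (- g x)))
    (h x).

End ConstrainedProblem.

Inductive decay_law (R : realType) :=
| Exponential of R            (* c0 *)
| FiniteTime of R & R         (* k, gamma *)
| FixedTime of R & R & R & R  (* a, b, gamma, delta *)
| PrescribedTime of R & R.    (* mu, T *)

Section DecayLaws.
Context {R : realType}.
Implicit Types law : decay_law R.

Definition law_wf law : Prop :=
  match law with
  | Exponential c0 => 0 < c0
  | FiniteTime k gam => 0 < k /\ 0 < gam < 1
  | FixedTime a b gam del => [/\ 0 < a, 0 < b, 0 < gam < 1 & 1 < del]
  | PrescribedTime mu T => 0 < mu /\ 0 < T
  end.

Definition sigma law (v t : R) : R :=
  match law with
  | Exponential c0 => c0 * v
  | FiniteTime k gam => k * v `^ gam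
  | FixedTime a b gam del => a * v `^ gam + b * v `^ del
  | PrescribedTime mu T => mu / (T - t) * v
  end.

(* The admissible times are those of [0, horizon law). *)
Definition horizon law : \bar R :=
  if law is PrescribedTime _ T then T%:E else +oo%E.

Definition to_horizon law : set_system R :=
  if law is PrescribedTime _ T then T^'- else +oo.

(* Here v t stands for V(z(t)). *)
Definition timing law (v : R -> R) : Prop :=
  match law with
  | Exponential c0 => forall t : R, 0 <= t -> v t <= v 0 * expR (- (c0 * t))
  | FiniteTime k gam =>
      exists2 t0 : R, 0 <= t0 <= v 0 `^ (1 - gam) / (k * (1 - gam))
                & forall t : R, t0 <= t -> v t = 0
  | FixedTime a b gam del =>
      exists2 t0 : R, 0 <= t0 <= 1 / (a * (1 - gam)) + 1 / (b * (del - 1))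
                & forall t : R, t0 <= t -> v t = 0
  | PrescribedTime _ T => v t @[t --> T^'-] --> (0 : R)
  end.

End DecayLaws.

Section Dynamics.
Context {R : realType} {N : nat}.
Variables (S : 'rV[R]_N -> 'rV[R]_N) (law : decay_law R).

Definition V_of (z : 'rV[R]_N) : R := 2^-1 * norm2 (S z) ^+ 2.

Definition zero_set : set 'rV[R]_N := [set z | S z = 0].

Definition gradS_S (z : 'rV[R]_N) : 'rV[R]_N := S z *m ('J S z)^T.

Definition feedback (z : 'rV[R]_N) (t : R) : 'rV[R]_N :=
  if S z == 0 then 0
  else - (sigma law (V_of z) t / norm2 (gradS_S z) ^+ 2) *: gradS_S z.

Definition time_interval (tau : \bar R) : set R :=
  [set t | 0 <= t /\ (t%:E < tau)%E].

(* A trajectory on [0, tau) with initial time 0.  It solves the equation in the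
   classical sense (two-sided derivative for t > 0) as long as S <> 0.  When it
   reaches the zero set of S in finite time it may do so with nonzero speed, so
   only the right derivative is prescribed there.  The third condition says
   that the feedback formula never divides by zero along the trajectory.  The
   values of z outside [0, tau) are irrelevant. *)
Definition trajectory (tau : \bar R) (z : R -> 'rV[R]_N) : Prop :=
  [/\ (0 < tau <= horizon law)%E,
      {within time_interval tau, continuous z},
      forall t, time_interval tau t -> S (z t) != 0 -> gradS_S (z t) != 0,
      forall t, time_interval tau t -> right_derivative z t (feedback (z t) t)
    & forall t, time_interval tau t -> 0 < t -> S (z t) != 0 ->
        is_derive t (1 : R) z (feedback (z t) t)].

Definition maximal_trajectory (tau : \bar R) (z : R -> 'rV[R]_N) : Prop :=
  trajectory tau z /\
  forall tau' z', trajectory tau' z' -> (tau <= tau')%E ->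
    (forall t, time_interval tau t -> z' t = z t) -> tau' = tau.

Definition forward_invariant (A : set 'rV[R]_N) : Prop :=
  forall tau z, maximal_trajectory tau z -> A (z 0) ->
    tau = horizon law /\ forall t, time_interval (horizon law) t -> A (z t).

Definition closed_in (U A : set 'rV[R]_N) : Prop :=
  exists2 C, closed C & A = U `&` C.

Definition sublevel (U : set 'rV[R]_N) (c : R) : set 'rV[R]_N :=
  [set z | U z /\ V_of z <= c].

Definition OLF_regular (U : set 'rV[R]_N) : Prop :=
  forall z, U z -> V_of z != 0 -> grad V_of z != 0.

Definition Lojasiewicz (U : set 'rV[R]_N) : Prop :=
  exists (Nb : set 'rV[R]_N) (cL alpha : R),
    [/\ Nb `<=` U, zero_set `&` U `<=` Nb°, 0 < cL, 0 <= alpha < 1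
      & forall z, Nb z -> cL * V_of z `^ alpha <= norm2 (grad V_of z)].

End Dynamics.

(* Main.v *)
Require Import Defs.
From mathcomp Require Import ring lra zify.

(* Along a trajectory the chain rule gives V' = <grad V, z'> = - sigma as long
   as S <> 0, because grad V = (grad S)^T S; each decay law is then integrated
   explicitly, and V -> 0 forces S -> 0.  Staying in the sublevel set for all
   admissible times is the invariance assumed of the threshold.  What remains
   is that trajectories exist.  S is only of class C^1, so the feedback is
   merely continuous where S <> 0 and a local solution comes from Peano's
   theorem; Zorn's lemma extends it to a maximal one. *)

(** The feedback need not be continuous on the zero set of [S], so Peano's theorem is applied only
    where both [S] and [gradS_S S] are nonzero; a start in the zero set receives the constant
    trajectory. For the same reason V' = - sigma is known only while V > 0, although V may vanish in
    finite time. Integration therefore works backwards from a time t with V > 0: by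
    [decay_positive_before] a zero of V is never left again, so V > 0 on all of [0, t], and
    primitives singular at 0, such as a logarithm or a negative power, are legitimate there. For the
    laws with a settling time, assuming V > 0 after that time yields a contradiction. Global
    existence is obtained from maximality: [forward_invariant] also says that a maximal trajectory
    lasts up to the horizon. *)

Local Open Scope classical_set_scope.
Local Open Scope ring_scope.

(** * Peano's existence theorem *)

(** Transports an ultrafilter on the step indices to the Euler values at a fixed time, where
    compactness then provides a limit. *)
Lemma fmap_ultra (T U : Type) (f : T -> U) (F : set_system T) :
  UltraFilter F -> UltraFilter (fmap f F).
Proof.
move=> FU; split=> [|G GF sFG]; first exact: fmap_proper_filter.
apply/seteqP; split=> A GA; last exact: sFG.
have [//|FnA] := in_ultra_setVsetC (f @^-1` A) FU.
have [y [Ay nAy]] := filter_ex (filterI GA (sFG (~` A) FnA)).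
by have := nAy Ay.
Qed.

Section Euler.
Context {R : realType} {V : normedModType R}.
Variables (F : V -> R -> V) (z0 : V).

Definition euler (h : R) (k : nat) : V :=
  iteri k (fun j y => y + h *: F y (j%:R * h)) z0.

(** The increment telescopes into terms [h *: (F - w)]. With [w = 0] this is the Lipschitz bound of
    the scheme; with [w] the field at a limit point it is the discrete form of the differential
    equation. *)
Lemma euler_increment (h : R) (w : V) (e : R) (m k : nat) : 0 <= h ->
  (forall j, (m <= j < m + k)%N -> `|F (euler h j) (j%:R * h) - w| <= e) ->
  `|euler h (m + k) - euler h m - (k%:R * h) *: w| <= e * (k%:R * h).
Proof.
move=> h0; elim: k => [|k IH] Hj.
  by rewrite addn0 !mul0r scale0r subr0 subrr normr0 mulr0.
have {}IH := IH (fun j Hj' => Hj j ltac:(lia)).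
have Hk := Hj (m + k)%N ltac:(lia).
rewrite addnS /= -/(euler h (m + k)).
set y := euler h (m + k) in IH Hk *; set f := F _ _ in Hk *.
have -> : y + h *: f - euler h m - (k.+1%:R * h) *: w =
          (y - euler h m - (k%:R * h) *: w) + h *: (f - w).
  rewrite -natr1 mulrDl mul1r scalerDl scalerBr opprD !addrA.
  by congr (_ - _); rewrite (addrAC y) (addrAC (y - _)).
apply: le_trans (ler_normD _ _) _.
rewrite -natr1 mulrDl mulrDr mul1r lerD// normrZ ger0_norm// mulrC.
by rewrite ler_wpM2r.
Qed.

End Euler.

Section BoundedPeano.
Context {R : realType} {N : nat}.
Notation V := ('rV[R]_N).
Variables (F : V -> R -> V) (z0 : V) (M : R).
Hypothesis F_bounded : forall y t, `|F y t| <= M.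

Lemma euler_lipschitz (h : R) (m k : nat) : 0 <= h -> (m <= k)%N ->
  `|euler F z0 h k - euler F z0 h m| <= M * ((k%:R - m%:R) * h).
Proof.
move=> h0 mk; rewrite -natrB// -{1}(subnKC mk).
have := @euler_increment _ _ F z0 h 0 M m (k - m)%N h0.
rewrite scaler0 subr0; apply => j _; by rewrite subr0.
Qed.

Lemma euler_distance (h : R) (m k : nat) : 0 <= h ->
  `|euler F z0 h k - euler F z0 h m| <= M * `|k%:R * h - m%:R * h|.
Proof.
move=> h0; rewrite -mulrBl normrM (ger0_norm h0).
have [mk|/ltnW km] := leqP m k.
  by rewrite ger0_norm ?subr_ge0 ?ler_nat// euler_lipschitz.
by rewrite distrC (distrC (k%:R)) ger0_norm ?subr_ge0 ?ler_nat// euler_lipschitz.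
Qed.

(** [approx n t] reads the scheme of step 1/(n+1) at its last node not after [t]. *)
Let step (n : nat) : R := n.+1%:R^-1.
Let idx (n : nat) (t : R) : nat := Num.truncn (t * n.+1%:R).
Let approx (n : nat) (t : R) : V := euler F z0 (step n) (idx n t).

Let step_gt0 n : 0 < step n. Proof. by rewrite invr_gt0 ltr0n. Qed.

Let idx_bound n t : 0 <= t -> (idx n t)%:R * step n <= t < (idx n t)%:R * step n + step n.
Proof.
move=> t0.
have /truncn_itv /andP[l u] : 0 <= t * n.+1%:R by rewrite mulr_ge0.
rewrite ler_pdivrMr ?ltr0n// l /=.
by rewrite -{2}[step n]mul1r -mulrDl natr1 ltr_pdivlMr ?ltr0n.
Qed.

Let M_ge0 : 0 <= M. Proof. exact: le_trans (normr_ge0 _) (F_bounded z0 0). Qed.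

Let approx_bounded n t : 0 <= t -> `|approx n t - z0| <= M * t.
Proof.
move=> t0; have := euler_distance 0 (idx n t) (ltW (step_gt0 n)).
rewrite mul0r subr0 ger0_norm; last by rewrite mulr_ge0// ltW.
move/le_trans; apply; rewrite ler_wpM2l//.
by have /andP[] := idx_bound n t0.
Qed.

(* The Euler polygons are replaced by step functions and their limit is taken
   pointwise along an ultrafilter, which exists by compactness alone; the
   differential equation passes to the limit because its discrete form, a bound
   on increments, is already uniform in the step. *)
Lemma bounded_Peano : exists z : R -> V,
  [/\ z 0 = z0,
      forall t, 0 <= t -> `|z t - z0| <= M * t
    & forall t, 0 <= t -> {for (z t, t), continuous (fun w => F w.1 w.2)} ->
      forall e, 0 < e -> exists2 d, 0 < d & forall a b, 0 <= a <= b ->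
        `|a - t| < d -> `|b - t| < d ->
        `|z b - z a - (b - a) *: F (z t) t| <= e * (b - a)].
Proof.
have [G [GU sG]] := ultraFilterLemma (@eventually_filter).
(* The values at time [t] stay in a closed ball, compact in finite dimension, and an ultrafilter on
   a compact set converges. For negative [t] the value [z0] is a dummy. *)
have cvgz t : exists y : V, 0 <= t -> approx n t @[n --> G] --> y.
  have [t0|t0] := leP 0 t; last by exists z0.
  have Kc : compact [set y : V | `|y - z0| <= M * t].
    apply: bounded_closed_compact.
      exists (M * t + `|z0|); split; first exact: num_real.
      move=> x /ltW xM y /= yz; apply: le_trans xM.
      by rewrite -(subrK z0 y) (le_trans (ler_normD _ _))// lerD2r.
    rewrite (_ : [set _ | _] = (fun y : V => `|y - z0|) @^-1` [set x | x <= M * t])//.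
    apply: closed_comp; last exact: closed_le.
    by move=> y _; exact: cvg_norm (cvgB cvg_id (cvg_cst z0)).
  move: Kc; rewrite compact_ultra => /(_ (fmap (approx ^~ t) G)) [].
  - exact: fmap_ultra.
  - by apply: (@filterE _ G) => n; exact: approx_bounded.
  - by move=> y [_ yl]; exists y.
pose z t := sval (cid (cvgz t)).
have zl t : 0 <= t -> approx n t @[n --> G] --> z t.
  exact: (svalP (cid (cvgz t))).
have step_cvg : step n @[n --> G] --> (0 : R).
  exact: cvg_trans (cvg_app _ sG) cvg_harmonic.
have idx_cvg t : 0 <= t -> (idx n t)%:R * step n @[n --> G] --> t.
  move=> t0; apply: (@squeeze_cvgr _ _ _ _ (fun n => t - step n) (cst t)).
  - apply: filterE => n; have /andP[u v] := idx_bound n t0.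
    by rewrite /cst u andbT lerBlDr ltW.
  - by rewrite -[X in _ --> X]subr0; apply: cvgB; [exact: cvg_cst|].
  - exact: cvg_cst.
have zM t : 0 <= t -> `|z t - z0| <= M * t.
  move=> t0; apply: (@closed_cvg _ _ G _ (fun n => `|approx n t - z0|) [set x | x <= M * t]).
  - exact: closed_le.
  - by apply: filterE => n; exact: approx_bounded.
  - by apply: cvg_norm; apply: cvgB; [exact: zl|exact: cvg_cst].
exists z; split => //.
  apply/eqP; rewrite -subr_eq0 -normr_eq0 eq_le normr_ge0 andbT.
  by rewrite (le_trans (zM 0 _))// mulr0.
move=> t t0 cF e e0.
have /cvgrPdist_le/(_ e e0)/nbhs_ballP[d /= d0 Hd] := cF.
have HF y s : `|y - z t| < d -> `|s - t| < d -> `|F y s - F (z t) t| <= e.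
  move=> yd sd; rewrite distrC; apply: (Hd (y, s)).
  by split => /=; rewrite -ball_normE /ball_ /= distrC.
have M1 : 0 < M + 1 by rewrite ltr_wpDl.
(* With times and step within [d'], the nodes involved lie less than [2 * d'] from [t] and from its
   own node. The scheme thus moves by at most [2 * M * d' <= d / 2], and another [d / 4] separates
   [approx n t] from [z t]: all stays within [d]. Adding 1 to [M] avoids a zero divisor and gives
   [d' <= d / 4]. *)
pose d' := d / 4 / (M + 1).
have d'0 : 0 < d' by rewrite !divr_gt0.
have d'E : d' * (M + 1) = d / 4 by rewrite divfK// gt_eqF.
exists d' => // a b /andP[a0 ab] at_ bt.
have b0 : 0 <= b := le_trans a0 ab.
pose w := F (z t) t.
(* Both sides of the discrete increment bound converge along [G], so it is enough to have it for
   almost all [n]. *)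
apply: (@ler_cvg_to _ G _ _
  (fun n => `|approx n b - approx n a - ((idx n b)%:R * step n - (idx n a)%:R * step n) *: w|)
  (fun n => e * ((idx n b)%:R * step n - (idx n a)%:R * step n))).
- apply: cvg_norm; apply: cvgB; first by apply: cvgB; exact: zl.
  apply: cvgZ; last exact: cvg_cst.
  by apply: cvgB; exact: idx_cvg.
- apply: cvgM; first exact: cvg_cst.
  by apply: cvgB; exact: idx_cvg.
have G1 : \forall n \near G, `|z t - approx n t| < d / 4.
  by apply: (@cvgr_dist_lt _ _ _ _ _ _ _ (zl t t0)); rewrite divr_gt0.
have G2 : \forall n \near G, step n < d'.
  apply: filterS (@cvgr_dist_lt _ _ _ _ _ _ _ step_cvg d' d'0) => n.
  by rewrite sub0r normrN ger0_norm// ltW.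
near=> n.
have n1 : `|z t - approx n t| < d / 4 by near: n.
have n2 : step n < d' by near: n.
have iab : (idx n a <= idx n b)%N by rewrite le_truncn// ler_wpM2r.
rewrite -mulrBl -natrB// /approx.
rewrite -{1}(subnKC iab); apply: euler_increment; first exact: ltW.
rewrite subnKC// => j /andP[aj jb].
have /andP[la ua] := idx_bound n a0.
have /andP[lb ub] := idx_bound n b0.
have /andP[lt_ ut] := idx_bound n t0.
have jl : (idx n a)%:R * step n <= j%:R * step n by rewrite ler_wpM2r ?ler_nat// ltW.
have ju : j%:R * step n <= (idx n b)%:R * step n 
  by rewrite ler_wpM2r ?ler_nat 1?ltnW// ltW.
have s0 := step_gt0 n.
have d'M : 0 <= M * d' by rewrite mulr_ge0// ltW.
have d'd : d' <= d / 4 by lra.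
move: at_ bt; rewrite !ltr_norml => /andP[at1 at2] /andP[bt1 bt2].
apply: HF; last by rewrite ltr_norml; apply/andP; split; lra.
rewrite -(subrK (approx n t) (euler _ _ _ _)) -addrA.
apply: le_lt_trans (ler_normD _ _) _.
have : `|approx n t - z t| < d / 4 by rewrite distrC.
suff : `|euler F z0 (step n) j - approx n t| <= d / 2 by lra.
apply: le_trans (euler_distance _ _ (ltW s0)) _.
have : `|j%:R * step n - (idx n t)%:R * step n| <= 2 * d'.
  by rewrite ler_norml; apply/andP; split; lra.
move=> /(ler_wpM2l M_ge0)/le_trans; apply.
lra.
Unshelve. all: by end_near. Qed.

End BoundedPeano.

(** The field is cut off outside a small cylinder on which continuity bounds it, and the time is
    short enough for the solution to stay inside. The first-order expansion over [0 <= s] is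
    one-sided at [t = 0] and two-sided later, which serves both kinds of derivative. *)
Lemma Peano (R : realType) (N : nat) (F : 'rV[R]_N -> R -> 'rV[R]_N)
  (z0 : 'rV[R]_N) (r : R) : 0 < r ->
  (forall y t, `|y - z0| < r -> `|t| < r ->
     {for (y, t), continuous (fun w => F w.1 w.2)}) ->
  exists (T : R) (z : R -> 'rV[R]_N),
  [/\ 0 < T, T <= r, z 0 = z0, forall t, 0 <= t < T -> `|z t - z0| < r
    & forall t, 0 <= t < T ->
      forall e, 0 < e -> exists2 d, 0 < d & forall s, 0 <= s -> `|s - t| < d ->
        `|z s - z t - (s - t) *: F (z t) t| <= e * `|s - t|].
Proof.
move=> r0 cF.
pose M := `|F z0 0| + 1.
have M0 : 0 < M by rewrite ltr_wpDl.
have /cvgrPdist_le/(_ 1 ltr01)/nbhs_ballP[d /= d0 Hd] :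
  {for (z0, 0), continuous (fun w => F w.1 w.2)}.
  by apply: cF; rewrite ?subrr normr0.
have FM y s : `|y - z0| < d -> `|s| < d -> `|F y s| <= M.
  move=> yd sd; rewrite -(subrK (F z0 0) (F y s)) (le_trans (ler_normD _ _))//.
  rewrite /M addrC lerD2l distrC; apply: (Hd (y, s)).
  by split => /=; rewrite -ball_normE /ball_ /= distrC// subr0.
pose d1 := Num.min d r.
have d10 : 0 < d1 by rewrite lt_min d0.
(* The jump of [G] at the boundary of the cylinder is harmless: [bounded_Peano] wants a global
   bound, but continuity only at points of the solution. *)
pose G y t := if (`|y - z0| < d1) && (`|t| < d1) then F y t else 0.
have GM y t : `|G y t| <= M.
  rewrite /G; case: ifPn => [/andP[]|_]; last by rewrite normr0 ltW.
  by rewrite !lt_min => /andP[yd _] /andP[td _]; exact: FM.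
have [z [z00 zM zd]] := bounded_Peano z0 GM.
(* At speed at most [M], a distance [d1] cannot be covered before time [d1 / M]. *)
pose T := Num.min d1 (d1 / M).
have T0 : 0 < T by rewrite lt_min d10 divr_gt0.
have zt t : 0 <= t < T -> `|z t - z0| < d1 /\ `|t| < d1.
  move=> /andP[t0]; rewrite lt_min => /andP[td tM]; rewrite ger0_norm//; split => //.
  by rewrite (le_lt_trans (zM t t0))// mulrC -ltr_pdivlMr.
have d1r : d1 <= r by rewrite ge_min lexx orbT.
exists T, z; split => //.
- by rewrite ge_min d1r.
- by move=> t /zt[? _]; exact: lt_le_trans d1r.
move=> t tT e e0; have [zt1 t1] := zt _ tT; have /andP[t0 _] := tT.
have GE : G (z t) t = F (z t) t by rewrite /G zt1 t1.
have cG : {for (z t, t), continuous (fun w => G w.1 w.2)}; last first.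
  have [d' d'0 Hd'] := zd t t0 cG e e0; exists d' => // s s0 sd.
  rewrite -GE; have [ts|/ltW st] := leP t s.
    by rewrite (ger0_norm (_ : 0 <= s - t)) ?subr_ge0// Hd' ?t0// subrr normr0.
  have := Hd' s t; rewrite s0 st subrr normr0 => /(_ erefl sd d'0).
  have -> : z s - z t - (s - t) *: G (z t) t = - (z t - z s - (t - s) *: G (z t) t).
    by rewrite -[s - t]opprB scaleNr opprK opprB addrC opprB.
  by rewrite normrN (distrC s t) (ger0_norm (_ : 0 <= t - s)) ?subr_ge0.
have nG : \forall w \near (z t, t), F w.1 w.2 = G w.1 w.2.
  have c1 : \forall w \near (z t, t), `|w.1 - z0| < d1.
    apply: (@cvgr_lt _ _ (nbhs (z t, t)) _ (fun w : 'rV[R]_N * R => `|w.1 - z0|) `|z t - z0|) => //.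
    by apply: cvg_norm; apply: cvgB; [exact: cvg_fst|exact: cvg_cst].
  have c2 : \forall w \near (z t, t), `|w.2| < d1.
    apply: (@cvgr_lt _ _ (nbhs (z t, t)) _ (fun w : 'rV[R]_N * R => `|w.2|) `|t|) => //.
    by apply: cvg_norm; exact: cvg_snd.
  by apply: filterS2 c1 c2 => w w1 w2; rewrite /G w1 w2.
rewrite /prop_for /continuous_at /= GE.
apply: cvg_trans (cF _ _ (lt_le_trans zt1 d1r) (lt_le_trans t1 d1r)).
exact: near_eq_cvg.
Qed.

(** * Functions of class C^1 *)

Section Limits.
Context {R : realType} {T : Type} (F : set_system T) {FF : Filter F}.

Lemma cvg_row n (f : T -> 'rV[R]_n) (l : 'rV[R]_n) :
  (forall j, f x 0 j @[x --> F] --> l 0 j) -> f x @[x --> F] --> l.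
Proof.
move=> fl; apply/cvg_ballP => e e0.
have : \forall x \near F, forall j, ball (l 0 j) e (f x 0 j).
  by apply: filter_forall => j; exact: (@cvg_ball _ _ _ _ _ _ _ (fl j)).
by apply: filterS => x fx; split=> // i j; rewrite (ord1 i).
Qed.

Lemma cvg_sum_seq (W : normedModType R) (I : Type) (s : seq I)
    (f : I -> T -> W) (l : I -> W) :
  (forall i, f i x @[x --> F] --> l i) ->
  \sum_(i <- s) f i x @[x --> F] --> \sum_(i <- s) l i.
Proof.
move=> fl; elim: s => [|i s IH].
  by rewrite big_nil; under eq_fun do rewrite big_nil; exact: cvg_cst.
by rewrite big_cons; under eq_fun do rewrite big_cons; exact: cvgD (fl i) IH.
Qed.

End Limits.

Section ClassC1.
Context {R : realType}.
Implicit Types V W : normedModType R.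

Lemma class_C1_continuous V W (f : V -> W) : class_C 1 f -> continuous f.
Proof. by move=> [df _] x; exact: differentiable_continuous. Qed.

Lemma class_CS k V W (f : V -> W) : class_C k.+1 f -> class_C k f.
Proof.
elim: k V W f => [|k IH] V W f; first exact: class_C1_continuous.
by move=> [df Df]; split=> // v; exact: IH.
Qed.

Lemma class_C1_cst V W (w : W) : class_C 1 (fun _ : V => w).
Proof.
split=> [x|v x]; first exact: differentiable_cst.
have -> : 'D_v (fun _ : V => w) = cst 0 by apply/funext => y; exact: derive_cst.
exact: cvg_cst.
Qed.

Lemma class_C1D V W (f g : V -> W) :
  class_C 1 f -> class_C 1 g -> class_C 1 (fun x => f x + g x).
Proof.
move=> [df cf] [dg cg]; split=> [x|v]; first exact: differentiableD.
have -> : 'D_v (fun x => f x + g x) = (fun x => 'D_v f x + 'D_v g x).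
  by apply/funext => y; apply: (@deriveD _ _ _ f g); exact: diff_derivable.
by move=> x; exact: cvgD (cf v x) (cg v x).
Qed.

Lemma class_C1Zl V W (k : V -> R) (w : W) :
  class_C 1 k -> class_C 1 (fun x => k x *: w).
Proof.
move=> [dk ck]; split=> [x|v]; first exact: differentiableZl.
have -> : 'D_v (fun x => k x *: w) = (fun x => 'D_v k x *: w).
  apply/funext => y; rewrite !deriveE//; last exact: differentiableZl.
  by rewrite diffZl.
by move=> x; apply: cvgZ; [exact: ck|exact: cvg_cst].
Qed.

Lemma class_C1N V W (f : V -> W) : class_C 1 f -> class_C 1 (fun x => - f x).
Proof.
move=> [df cf]; split=> [x|v]; first exact: differentiableN.
have -> : 'D_v (fun x => - f x) = (fun x => - 'D_v f x).
  by apply/funext => y; apply: (@deriveN _ _ _ f); exact: diff_derivable.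
by move=> x; exact: cvgN (cf v x).
Qed.

Lemma class_C1M V (f g : V -> R) :
  class_C 1 f -> class_C 1 g -> class_C 1 (fun x => f x * g x).
Proof.
move=> C1f C1g; have [df cf] := C1f; have [dg cg] := C1g.
split=> [x|v]; first exact: differentiableM.
have -> : 'D_v (fun x => f x * g x) = (fun x => f x *: 'D_v g x + g x *: 'D_v f x).
  by apply/funext => y; apply: (@deriveM _ _ f g); exact: diff_derivable.
move=> x; apply: cvgD.
  by apply: cvgZ; [exact: class_C1_continuous|exact: cg].
by apply: cvgZ; [exact: class_C1_continuous|exact: cf].
Qed.

Lemma class_C1_sum V W (I : Type) (s : seq I) (f : I -> V -> W) :
  (forall i, class_C 1 (f i)) -> class_C 1 (fun x => \sum_(i <- s) f i x).
Proof.
move=> Cf; elim: s => [|i s IH].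
  by under eq_fun do rewrite big_nil; exact: class_C1_cst.
by under eq_fun do rewrite big_cons; exact: class_C1D (Cf i) IH.
Qed.

(** [class_C] controls the derivative in one fixed direction at a time. A linear inner map sends the
    direction [v] to the fixed direction [L v]; a nonlinear one would let it vary with the point. *)
Lemma class_C1_comp_linear V V' W (L : {linear V -> V'}) (f : V' -> W) :
  continuous L -> class_C 1 f -> class_C 1 (fun x => f (L x)).
Proof.
move=> cL [df cf].
have dfL x : differentiable (f \o L) x.
  by apply: differentiable_comp => //; exact: linear_differentiable.
split=> // v.
have -> : 'D_v (fun x => f (L x)) = (fun x => 'D_(L v) f (L x)).
  apply/funext => y; rewrite (deriveE v (dfL y)) deriveE// diff_comp//=; last first.
    exact: linear_differentiable.
  by rewrite diff_lin.
by move=> x; apply: (@cvg_comp _ _ _ L ('D_(L v) f)); [exact: cL|exact: cf].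
Qed.

(** Here the outer derivative is a scalar factor, so again only fixed directions occur. *)
Lemma class_C1_comp_real V (phi dphi : R -> R) (f : V -> R) :
  (forall x, is_derive (f x) 1 phi (dphi (f x))) ->
  (forall x, {for f x, continuous dphi}) ->
  class_C 1 f -> class_C 1 (fun x => phi (f x)).
Proof.
move=> dP cP C1f; have [df cf] := C1f.
have dphi' x : differentiable phi (f x).
  by apply/derivable1_diffP; apply: ex_derive.
have dpf x : differentiable (phi \o f) x by exact: differentiable_comp.
split=> // v.
have -> : 'D_v (fun x => phi (f x)) = (fun x => 'D_v f x * dphi (f x)).
  apply/funext => y; rewrite (deriveE v (dpf y)) deriveE// diff_comp//=.
  by rewrite diff1E// derive1E derive_val.
move=> x; apply: cvgM; first exact: cf.
apply: (@cvg_comp _ _ _ f dphi); last exact: cP.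
exact: class_C1_continuous.
Qed.

Lemma class_C1_entry V m n (f : V -> 'M[R]_(m, n)) i j :
  class_C 1 f -> class_C 1 (fun x => f x i j).
Proof.
move=> [df cf]; split=> [x|v].
  apply: (@differentiable_comp _ _ _ _ f (fun M : 'M[R]_(m, n) => M i j)) => //.
  exact: differentiable_coord.
have -> : 'D_v (fun x => f x i j) = (fun x => ('D_v f x) i j).
  by apply/funext => y; rewrite derive_mx ?mxE//; exact: diff_derivable.
move=> x; apply: (@cvg_comp _ _ _ ('D_v f) (fun M : 'M[R]_(m, n) => M i j)).
  exact: cf.
exact: coord_continuous.
Qed.

Lemma class_C1_row V n (f : V -> 'rV[R]_n) :
  (forall j, class_C 1 (fun x => f x 0 j)) -> class_C 1 f.
Proof.
move=> Cf.
have -> : f = (fun x => \sum_(j < n) f x 0 j *: delta_mx 0 j).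
  by apply/funext => x; exact: row_sum_delta.
by apply: class_C1_sum => j; exact: class_C1Zl.
Qed.

Lemma class_C1_row_mx V m n (f : V -> 'rV[R]_m) (g : V -> 'rV[R]_n) :
  class_C 1 f -> class_C 1 g -> class_C 1 (fun x => row_mx (f x) (g x)).
Proof.
move=> Cf Cg; apply: class_C1_row => j.
by under eq_fun do rewrite mxE; case: (fintype.split j) => k; exact: class_C1_entry.
Qed.

Lemma class_C1_lsubmx W m n (f : 'rV[R]_m -> W) :
  class_C 1 f -> class_C 1 (fun x : 'rV[R]_(m + n) => f (lsubmx x)).
Proof.
apply: class_C1_comp_linear => x.
exact/differentiable_continuous/differentiable_lsubmx.
Qed.

Lemma class_C1_rsubmx W m n (f : 'rV[R]_n -> W) :
  class_C 1 f -> class_C 1 (fun x : 'rV[R]_(m + n) => f (rsubmx x)).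
Proof.
apply: class_C1_comp_linear => x.
exact/differentiable_continuous/differentiable_rsubmx.
Qed.

Lemma class_C1_id n : class_C 1 (@id 'rV[R]_n).
Proof.
split=> [x|v]; first exact: ex_diff.
have -> : 'D_v (@id 'rV[R]_n) = cst v by apply/funext => x; exact: derive_id.
exact: cst_continuous.
Qed.

Lemma class_C1_sqrt V (f : V -> R) : (forall x, 0 < f x) ->
  class_C 1 f -> class_C 1 (fun x => Num.sqrt (f x)).
Proof.
move=> f0; apply: (@class_C1_comp_real _ _ (fun x => (2 * Num.sqrt x)^-1)).
  by move=> x; exact: is_derive1_sqrt.
move=> x; apply: cvgV; first by rewrite mulf_neq0// gt_eqF// sqrtr_gt0.
apply: cvgM; first exact: cvg_cst.
exact: sqrt_continuous.
Qed.

(** Turns Jacobian entries into directional derivatives, the only objects about which [class_C 2]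
    gives information. *)
Lemma jacobian_entry m n (f : 'rV[R]_m -> 'rV[R]_n) x i j :
  differentiable f x -> 'J f x i j = 'D_(delta_mx 0 i) f x 0 j.
Proof. by move=> df; rewrite deriveEjacobian// -rowE [RHS]mxE. Qed.

End ClassC1.

(** The gradients in the first block cost one order of smoothness. The smoothing supplies the rest:
    [eps ^+ 2 > 0] keeps every square root away from its singularity at 0. *)
Lemma stationarity_C1 (R : realType) (n p q : nat)
    (J : 'rV[R]_n -> R) (g : 'rV[R]_n -> 'rV[R]_p) (h : 'rV[R]_n -> 'rV[R]_q)
    (eps : R) :
  class_C 2 J -> class_C 2 g -> class_C 2 h -> 0 < eps ->
  class_C 1 (stationarity J g h eps).
Proof.
move=> C2J C2g C2h eps0.
have CJ v : class_C 1 ('D_v J) := C2J.2 v.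
have [dg _] := C2g; have Cg v : class_C 1 ('D_v g) := C2g.2 v.
have [dh _] := C2h; have Ch v : class_C 1 ('D_v h) := C2h.2 v.
have e2 (x : R) : 0 <= x -> 0 < x + eps ^+ 2 by move=> x0; rewrite ltr_wpDl// exprn_gt0.
have Cx (W : normedModType R) (f : 'rV[R]_n -> W) : class_C 1 f ->
    class_C 1 (fun z : 'rV[R]_(n + p + q) => f (lsubmx (lsubmx z))).
  by move=> Cf; apply: (@class_C1_lsubmx _ _ _ _ (fun y => f (lsubmx y))); exact: class_C1_lsubmx.
have Cl i : class_C 1 (fun z : 'rV[R]_(n + p + q) => rsubmx (lsubmx z) 0 i).
  apply: (@class_C1_lsubmx _ _ _ _ (fun y => rsubmx y 0 i)).
  by apply: (@class_C1_rsubmx _ _ _ _ (fun y => y 0 i)); apply/class_C1_entry/class_C1_id.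
have Cm i : class_C 1 (fun z : 'rV[R]_(n + p + q) => rsubmx z 0 i).
  by apply: (@class_C1_rsubmx _ _ _ _ (fun y => y 0 i)); apply/class_C1_entry/class_C1_id.
rewrite /stationarity; apply: class_C1_row_mx; last by apply: Cx; exact: class_CS.
apply: class_C1_row_mx; apply: class_C1_row => j.
  under eq_fun do rewrite !mxE.
  apply: class_C1D; first apply: class_C1D.
  - exact: (Cx _ ('D_(delta_mx 0 j) J)).
  - apply: class_C1_sum => i; under eq_fun do rewrite [map_mx _ _ _ _]mxE [_^T _ _]mxE.
    apply: class_C1M.
      apply: class_C1M; first exact: class_C1_cst.
      apply: class_C1D => //; apply: class_C1_sqrt.
        by move=> z; rewrite e2// sqr_ge0.
      by apply: class_C1D; [exact: class_C1M|exact: class_C1_cst].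
    under eq_fun do rewrite jacobian_entry//.
    by apply: (Cx _ (fun x => 'D_(delta_mx 0 j) g x 0 i)); exact: class_C1_entry.
  - apply: class_C1_sum => i; under eq_fun do rewrite [_^T _ _]mxE jacobian_entry//.
    apply: class_C1M => //.
    by apply: (Cx _ (fun x => 'D_(delta_mx 0 j) h x 0 i)); exact: class_C1_entry.
have Cgj : class_C 1 (fun z : 'rV[R]_(n + p + q) => g (lsubmx (lsubmx z)) 0 j).
  by apply: (Cx _ (fun x => g x 0 j)); apply/class_C1_entry/class_CS.
under eq_fun do rewrite [map2_mx _ _ _ _ _]mxE [(- g _) _ _]mxE /smoothed_FB.
have CN := class_C1N Cgj.
apply: class_C1D; last by apply: class_C1N; exact: class_C1D.
apply: class_C1_sqrt; first by move=> z; rewrite e2// addr_ge0// sqr_ge0.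
by apply: class_C1D; [apply: class_C1D; exact: class_C1M|exact: class_C1_cst].
Qed.

(** * The energy V and its chain rule *)

Section Euclidean.
Context {R : realType} {n : nat}.
Implicit Types u v : 'rV[R]_n.

Lemma dotvC u v : dotv u v = dotv v u.
Proof. by apply: eq_bigr => i _; rewrite mulrC. Qed.

Lemma dotvZl (a : R) u v : dotv (a *: u) v = a * dotv u v.
Proof. by rewrite mulr_sumr; apply: eq_bigr => i _; rewrite mxE mulrA. Qed.

Lemma dotvE u v : dotv u v = (u *m v^T) 0 0.
Proof. by rewrite mxE; apply: eq_bigr => i _; rewrite mxE. Qed.

Lemma dotvv_ge0 u : 0 <= dotv u u.
Proof. by apply: sumr_ge0 => i _; exact: sqr_ge0. Qed.

Lemma norm2_sqr u : norm2 u ^+ 2 = dotv u u.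
Proof. by rewrite sqr_sqrtr// dotvv_ge0. Qed.

Lemma sqr_entry_le_dotvv u i : u 0 i ^+ 2 <= dotv u u.
Proof.
rewrite /dotv (bigD1 i)//= -expr2 lerDl; apply: sumr_ge0 => j _.
exact: sqr_ge0.
Qed.

Lemma dotvv_eq0 u : (dotv u u == 0) = (u == 0).
Proof.
apply/eqP/eqP => [u0|->]; last by rewrite /dotv big1// => i _; rewrite mxE mul0r.
apply/rowP => i; rewrite mxE; apply/eqP; rewrite -sqrf_eq0 eq_le sqr_ge0 andbT.
by rewrite -u0 sqr_entry_le_dotvv.
Qed.

Lemma dotvv_gt0 u : (0 < dotv u u) = (u != 0).
Proof. by rewrite lt_neqAle dotvv_ge0 andbT eq_sym dotvv_eq0. Qed.

Lemma cvg_dotv (T : Type) (F : set_system T) {FF : Filter F}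
    (f g : T -> 'rV[R]_n) u v :
  f x @[x --> F] --> u -> g x @[x --> F] --> v ->
  dotv (f x) (g x) @[x --> F] --> dotv u v.
Proof.
move=> fu gv; apply: cvg_sum_seq => i; apply: cvgM.
  exact: cvg_comp fu (@coord_continuous _ _ _ 0 i u).
exact: cvg_comp gv (@coord_continuous _ _ _ 0 i v).
Qed.

End Euclidean.

Section EnergyFunction.
Context {R : realType} {N : nat}.
Variable S : 'rV[R]_N -> 'rV[R]_N.
Hypothesis S_C1 : class_C 1 S.

Lemma V_ofE z : V_of S z = 2^-1 * dotv (S z) (S z).
Proof. by rewrite /V_of norm2_sqr. Qed.

Lemma V_of_ge0 z : 0 <= V_of S z.
Proof. by rewrite V_ofE mulr_ge0// ?invr_ge0// dotvv_ge0. Qed.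

Lemma V_of_gt0 z : (0 < V_of S z) = (S z != 0).
Proof. by rewrite V_ofE pmulr_rgt0 ?invr_gt0// dotvv_gt0. Qed.

Lemma V_of_C1 : class_C 1 (V_of S).
Proof.
rewrite (_ : V_of S = (fun z => 2^-1 * \sum_j S z 0 j * S z 0 j)); last first.
  by apply/funext => z; rewrite V_ofE.
apply: class_C1M; first exact: class_C1_cst.
by apply: class_C1_sum => j; apply: class_C1M; exact: class_C1_entry.
Qed.

Lemma V_of_continuous : continuous (V_of S).
Proof. exact: class_C1_continuous V_of_C1. Qed.

(** The product rule gives [dotv (S z) (v *m 'J S z)], the factor 2 cancelling the one half in
    [V_of]; transposition moves the Jacobian onto [S z]. *)
Lemma derive_V_of z v : 'D_v (V_of S) z = dotv v (gradS_S S z).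
Proof.
have [dS _] := S_C1.
have dSj j : is_derive z v (fun y => S y 0 j) ('D_v S z 0 j).
  have [dSj _] := class_C1_entry 0 j S_C1.
  apply: DeriveDef; first exact/diff_derivable/dSj.
  by rewrite derive_mx ?mxE//; exact: diff_derivable.
have -> : V_of S = 2^-1 \*: (\sum_(j < N) ((fun y => S y 0 j) * (fun y => S y 0 j))).
  by apply/funext => y; rewrite V_ofE /dotv /= fct_sumE.
rewrite derive_val deriveEjacobian//.
have -> : \sum_(i < N) (S z 0 i *: (v *m 'J S z) 0 i + S z 0 i *: (v *m 'J S z) 0 i)
   = 2 * dotv (S z) (v *m 'J S z).
  rewrite /dotv mulr_sumr; apply: eq_bigr => i _; rewrite /GRing.scale /=; ring.
rewrite /GRing.scale /= mulKf// (dotvC v) !dotvE /gradS_S.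
by rewrite trmx_mul mulmxA.
Qed.

Lemma grad_V_of z : grad (V_of S) z = gradS_S S z.
Proof.
apply/rowP => i; rewrite mxE derive_V_of /dotv (bigD1 i)//= mxE !eqxx mul1r.
by rewrite big1 ?addr0// => j /negPf ji; rewrite mxE ji andbF mul0r.
Qed.

(** As the gradient of the C^1 function [V_of S], the field has directional derivatives as entries,
    and these are continuous by definition. *)
Lemma gradS_S_continuous : continuous (gradS_S S).
Proof.
have <- : grad (V_of S) = gradS_S S by apply/funext => z; exact: grad_V_of.
move=> z; apply: (@cvg_row _ _ (nbhs z)) => i.
rewrite mxE; under eq_fun do rewrite mxE.
exact: V_of_C1.2.
Qed.

End EnergyFunction.

Section RightDerivative.
Context {R : realType}.

Lemma right_derivative_continuous (W : normedModType R) (f : R -> W) (t : R) (v : W) :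
  right_derivative f t v -> f (t + h) @[h --> 0^'+] --> f t.
Proof.
move=> fv.
have : f t + h *: (h^-1 *: (f (t + h) - f t)) @[h --> 0^'+] --> f t + (0 : R) *: v.
  apply: cvgD; first exact: cvg_cst.
  apply: cvgZ => //; exact: cvg_at_right_filter cvg_id.
rewrite scale0r addr0; apply: cvg_trans; apply: near_eq_cvg; near=> h.
have h0 : h != 0 by rewrite gt_eqF//; near: h; exact: nbhs_right_gt.
by rewrite scalerA mulfV// scale1r addrC subrK.
Unshelve. all: by end_near. Qed.

(** Used to differentiate V at the initial time too. The linearization remainder of [G] is small
    relative to the increment of [f], and the difference quotients of [f] are eventually bounded by
    [|v| + 1], so the remainder divided by [h] vanishes. *)
Lemma right_derivative_comp (U W : normedModType R) (G : U -> W) (f : R -> U)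
    (t : R) (v : U) :
  differentiable G (f t) -> right_derivative f t v ->
  right_derivative (G \o f) t ('D_v G (f t)).
Proof.
move=> dG fv; have fc := right_derivative_continuous fv.
rewrite /right_derivative deriveE//; set L := 'd G (f t).
have Lc : continuous L by exact: diff_continuous.
pose r y := G y - G (f t) - L (y - f t).
have rE e : 0 < e -> \forall y \near f t, `|r y| <= e * `|y - f t|.
  move=> e0; have [_ /eqaddoP/(_ e e0)] := (diff_locallyP (f t) G).1 dG.
  rewrite -/L => H.
  have : \forall y \near f t, `|(G \o shift (f t) - (cst (G (f t)) + L)) (y - f t)|
         <= e * `|y - f t|.
    have sc : (y - f t) @[y --> f t] --> (0 : U).
      by rewrite -(subrr (f t)); apply: cvgB; [exact: cvg_id|exact: cvg_cst].
    exact: (sc _ H).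
  by apply: filterS => y /=; rewrite /r !fctE /= subrK opprD addrA.
have r0 : h^-1 *: r (f (t + h)) @[h --> 0^'+] --> (0 : W).
  apply/cvgrPdist_le => e e0.
  have M0 : 0 < `|v| + 1 by rewrite ltr_wpDl.
  have e1 : 0 < e / (`|v| + 1) by rewrite divr_gt0.
  have H1 := fc _ (rE _ e1).
  have H2 : \forall h \near 0^'+, `|h^-1 *: (f (t + h) - f t)| <= `|v| + 1.
    by apply: (@cvgr_norm_le _ _ _ _ _ _ _ fv); rewrite ltrDl.
  near=> h; rewrite sub0r normrN normrZ.
  have h1 : `|r (f (t + h))| <= e / (`|v| + 1) * `|f (t + h) - f t| by near: h.
  have h2 : `|h^-1 *: (f (t + h) - f t)| <= `|v| + 1 by near: h.
  apply: (@le_trans _ _ (e / (`|v| + 1) * (`|h^-1| * `|f (t + h) - f t|))).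
    by rewrite mulrCA ler_wpM2l.
  by rewrite -normrZ mulrAC ler_pdivrMr// ler_wpM2l// ltW.
have L0 : L (h^-1 *: (f (t + h) - f t)) @[h --> 0^'+] --> L v.
  exact: cvg_comp fv (Lc v).
have := @cvgD _ _ _ _ (at_right_proper_filter _) _ _ _ _ L0 r0.
rewrite addr0; apply: cvg_trans; apply: near_eq_cvg.
near=> h; rewrite /= !fctE linearZ/= -scalerDr /r.
by rewrite addrC subrK.
Unshelve. all: by end_near. Qed.

Lemma is_derive_comp (U W : normedModType R) (G : U -> W) (f : R -> U)
    (t : R) (v : U) :
  differentiable G (f t) -> is_derive t (1 : R) f v ->
  is_derive t (1 : R) (G \o f) ('D_v G (f t)).
Proof.
move=> dG [fd fv].
have df : differentiable f t by exact/derivable1_diffP.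
have dGf : differentiable (G \o f) t by exact: differentiable_comp.
apply: DeriveDef; first exact/derivable1_diffP.
by rewrite deriveE// diff_comp//= deriveE// -fv [in RHS]deriveE.
Qed.

End RightDerivative.

(** * Integration of the decay laws *)

Lemma is_derive1_comp_real (R : realType) (phi f : R -> R) (x a b : R) :
  is_derive (f x) 1 phi b -> is_derive x 1 f a -> is_derive x 1 (phi \o f) (b * a).
Proof.
move=> dphi df; apply: DeriveDef.
  apply/derivable1_diffP; apply: differentiable_comp; exact/derivable1_diffP/ex_derive.
rewrite -derive1E derive1_comp; [|exact: ex_derive|exact: ex_derive].
by rewrite !derive1E !derive_val.
Qed.

(** Nothing is asked of the derivative at the endpoints, which may be time 0 or a zero of V. *)
Lemma is_derive_le_cc (R : realType) (f df : R -> R) (a b K : R) : a <= b ->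
  (forall x, a < x < b -> is_derive x 1 f (df x)) ->
  (forall x, a < x < b -> df x <= K) ->
  {within `[a, b], continuous f} -> f b - f a <= K * (b - a).
Proof.
rewrite le_eqVlt => /predU1P[-> *|ab dF dK cf]; first by rewrite !subrr mulr0.
have dF' x : x \in `]a, b[ -> is_derive x 1 f (df x) by rewrite in_itv; exact: dF.
have [c cab ->] := MVT ab dF' cf.
rewrite ler_wpM2r ?subr_ge0; [by []|exact: ltW|].
by apply: dK; move: cab; rewrite in_itv.
Qed.

Lemma is_derive_linear (R : realType) (c x : R) : is_derive x 1 (fun s => c * s) c.
Proof.
by apply: (is_derive_eq (is_deriveZ c (is_derive_id x 1))); rewrite /GRing.scale/= mulr1.
Qed.

Section Decay.
Context {R : realType}.
Variables (law : decay_law R) (v : R -> R).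
Hypothesis law_ok : law_wf law.
Let I := time_interval (horizon law).
Hypothesis v_ge0 : forall t, I t -> 0 <= v t.
Hypothesis v_cont : {within I, continuous v}.
Hypothesis v_derive : forall t, I t -> 0 < t -> 0 < v t ->
  is_derive t (1 : R) v (- sigma law (v t) t).

Let I_le s t : I t -> 0 <= s <= t -> I s.
Proof.
move=> [t0 tl] /andP[s0 st]; split => //; apply: le_lt_trans tl.
by rewrite lee_fin.
Qed.

Let cont_cc a b : 0 <= a -> I b -> {within `[a, b], continuous v}.
Proof.
move=> a0 Ib; apply: continuous_subspaceW v_cont => s /=; rewrite in_itv/= => /andP[as_ sb].
by apply: I_le Ib _; rewrite (le_trans a0 as_).
Qed.

Lemma sigma_ge0 t x : I t -> 0 <= x -> 0 <= sigma law x t.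
Proof.
move=> [t0 tl] x0; move: law_ok tl; case: law => /=.
- by move=> c0 c00 _; rewrite mulr_ge0// ltW.
- by move=> k g [k0 _] _; rewrite mulr_ge0 ?powR_ge0// ltW.
- by move=> a b g d [a0 b0 _ _] _; rewrite addr_ge0// mulr_ge0 ?powR_ge0// ltW.
- by move=> m T [m0 _]; rewrite lte_fin => tT; rewrite mulr_ge0// divr_ge0 ?ltW// subr_gt0.
Qed.

(* Between the last zero of v before t and t, v is nonincreasing. *)
Lemma decay_positive_before s t : I t -> 0 < v t -> 0 <= s <= t -> 0 < v s.
Proof.
move=> It vt /andP[s0 st]; rewrite ltNge; apply/negP => vs.
(* The supremum [m] of [A] is the last zero: [v m <= 0] by continuity, since [A] accumulates at or
   contains [m], and [v] is positive on the open interval from [m] to [t]. *)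
pose A := [set x | s <= x <= t /\ v x <= 0].
have As : A s by split; rewrite ?lexx.
have Aub : ubound A t by move=> x [/andP[]].
have hA : has_sup A by split; [exists s|exists t].
pose m := sup A.
have sm : s <= m by apply: sup_upper_bound.
have mt : m <= t by apply: ge_sup => //; exists s.
have cst' := cont_cc s0 It.
have vm : v m <= 0.
  rewrite leNgt; apply/negP => vm.
  have : v @ within `[s, t] (nbhs m) --> v m.
    by apply: (subspace_continuousP _ _).1 cst' _ _; rewrite /= in_itv/= sm.
  move=> /cvgrPdist_lt/(_ _ vm); rewrite /within/= => /nbhs_ballP[d /= d0 Hd].
  have [x Ax mx] := sup_adherent d0 hA.
  have xm : x <= m by apply: sup_upper_bound.
  have [sxt vx] := Ax.
  have : `|v m - v x| < v m.
    apply: Hd; last by rewrite in_itv.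
    by rewrite /ball/= ger0_norm ?subr_ge0// ltrBlDr -ltrBlDl.
  by move/(le_lt_trans (ler_norm _)); rewrite ltrBlDl ltrDr ltNge vx.
have mlt : m < t.
  by rewrite lt_neqAle mt andbT; apply: contraTneq vt => <-; rewrite -leNgt.
have m0 : 0 <= m := le_trans s0 sm.
have pos x : m < x < t -> 0 < v x.
  move=> /andP[mx xt]; rewrite ltNge; apply/negP => vx.
  have : A x by split => //; rewrite (ltW xt) (le_trans sm (ltW mx)).
  by move/(sup_upper_bound hA); rewrite leNgt mx.
have Ix x : m < x < t -> I x.
  by move=> /andP[mx xt]; apply: I_le It _; rewrite (ltW xt) (le_trans m0 (ltW mx)).
have : v t - v m <= 0 * (t - m).
  apply: (@is_derive_le_cc _ v (fun x => - sigma law (v x) x)) => //.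
  - move=> x mx; apply: v_derive; [exact: Ix| |exact: pos].
    by have /andP[? _] := mx; exact: le_lt_trans m0 _.
  - move=> x mx; rewrite oppr_le0 sigma_ge0//; first exact: Ix.
    exact/ltW/pos.
  - exact: cont_cc.
by rewrite mul0r subr_le0 => /le_trans/(_ vm); rewrite leNgt vt.
Qed.


(* With phi a logarithm or a power and theta its elapsed-time counterpart, this
   integrates each of the decay laws. *)
Lemma decay_first_integral (phi dphi theta dtheta : R -> R) (a b : R) :
  0 <= a <= b -> I b -> 0 < v b ->
  (forall x : R, 0 < x -> is_derive x (1 : R) phi (dphi x)) ->
  (forall s : R, a <= s <= b -> is_derive s (1 : R) theta (dtheta s)) ->
  (forall s : R, a < s < b -> 0 < v s ->
    dphi (v s) * - sigma law (v s) s + dtheta s <= 0) ->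
  phi (v b) + theta b <= phi (v a) + theta a.
Proof.
move=> /andP[a0 ab] Ib vb dPhi dTh dle.
have pos s : a <= s <= b -> 0 < v s.
  by move=> /andP[as_ sb]; apply: decay_positive_before Ib vb _; rewrite sb (le_trans a0 as_).
rewrite -subr_le0 -(mul0r (b - a)).
apply: (@is_derive_le_cc _ (fun s => phi (v s) + theta s)
          (fun s => dphi (v s) * - sigma law (v s) s + dtheta s)) => //.
- move=> s /andP[as_ sb]; have sab : a <= s <= b by rewrite !ltW.
  have s0 : 0 < s := le_lt_trans a0 as_.
  apply: is_deriveD; last exact: dTh.
  apply: is_derive1_comp_real; first exact/dPhi/pos.
  apply: v_derive => //; last exact: pos.
  by apply: I_le Ib _; rewrite !ltW.
- by move=> s sab; apply: dle => //; apply: pos; have /andP[? ?] := sab; rewrite !ltW.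
- apply/subspace_continuousP => s; rewrite /= in_itv/= => sab.
  apply: cvgD.
    have vs : v x @[x --> within `[a, b] (nbhs s)] --> v s.
      by apply: (subspace_continuousP _ _).1 (cont_cc a0 Ib) _ _; rewrite /= in_itv.
    have phis : {for v s, continuous phi}.
      apply: differentiable_continuous; apply/derivable1_diffP.
      by have [] := dPhi _ (pos _ sab).
    exact: cvg_comp vs phis.
  apply: cvg_within_filter; apply: differentiable_continuous.
  by apply/derivable1_diffP; have [] := dTh _ sab.
Qed.

(** As long as [v > 0], the quantity [ln (v s) + c0 * s] does not increase. *)
Lemma exponential_decay c0 : law = Exponential c0 ->
  forall t, 0 <= t -> v t <= v 0 * expR (- (c0 * t)).
Proof.
move=> E t t0.
have It : I t by rewrite /I E; split => //=; exact: ltry.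
have [vt|vt] := leP (v t) 0.
  apply: le_trans vt _; rewrite mulr_ge0 ?expR_ge0// v_ge0//.
  by apply: I_le It _; rewrite lexx.
have v0 : 0 < v 0 by apply: decay_positive_before It vt _; rewrite lexx.
have := @decay_first_integral (@ln R) (fun x => x^-1) (fun s => c0 * s) (fun=> c0) 0 t.
rewrite lexx t0 mulr0 addr0 => /(_ erefl It vt) H.
have {}H : ln (v t) + c0 * t <= ln (v 0).
  refine (H (fun x x0 => is_derive1_ln x0) (fun s _ => is_derive_linear c0 s) _) => s _ vs.
  by rewrite E /= mulrN mulrCA mulVf ?gt_eqF// mulr1 addNr.
rewrite -(lnK (x := v t))// -{1}(lnK (x := v 0))// -expRD ler_expR.
by rewrite lerBrDr.
Qed.

Lemma finite_time_decay k gam : law = FiniteTime k gam ->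
  forall t, v 0 `^ (1 - gam) / (k * (1 - gam)) <= t -> v t = 0.
Proof.
move=> E t tge; have := law_ok; rewrite E /= => -[k0 /andP[g0 g1]].
have kg : 0 < k * (1 - gam) by rewrite mulr_gt0 ?subr_gt0.
have t0 : 0 <= t by apply: le_trans tge; rewrite divr_ge0 ?powR_ge0// ltW.
have It : I t by rewrite /I E; split => //=; exact: ltry.
apply/eqP; rewrite eq_le v_ge0// andbT leNgt; apply/negP => vt.
have := @decay_first_integral (fun x => x `^ (1 - gam)) (fun x => (1 - gam) * x `^ (1 - gam - 1))
  (fun s => k * (1 - gam) * s) (fun=> k * (1 - gam)) 0 t.
rewrite lexx t0 mulr0 addr0 => /(_ erefl It vt) H.
have {}H : v t `^ (1 - gam) + k * (1 - gam) * t <= v 0 `^ (1 - gam).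
  refine (H (fun x x0 => is_derive1_powR _ x0) (fun s _ => is_derive_linear _ s) _) => s _ vs.
  rewrite E /= (_ : _ * - _ = - (k * (1 - gam) * (v s `^ (1 - gam - 1) * v s `^ gam))); last by ring.
  rewrite -powRD; last by rewrite (gt_eqF vs) implybT.
  by rewrite (_ : 1 - gam - 1 + gam = 0) ?powRr0 ?mulr1 ?addNr//; ring.
have := powR_gt0 (1 - gam) vt.
move: tge; rewrite ler_pdivrMr// mulrC => tge; rewrite ltNge => /negP; apply.
by rewrite -(lerD2r (k * (1 - gam) * t)) add0r (le_trans H).
Qed.

(** Two phases, one per term of the bound: the [del] term brings [v] down to 1 by time [t1],
    whatever [v 0] is, and the [gam] term then takes it from 1 to 0. *)
Lemma fixed_time_decay a b gam del : law = FixedTime a b gam del ->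
  forall t, 1 / (a * (1 - gam)) + 1 / (b * (del - 1)) <= t -> v t = 0.
Proof.
move=> E t tge; have := law_ok; rewrite E /= => -[a0 b0 /andP[g0 g1] d1].
have ag : 0 < a * (1 - gam) by rewrite mulr_gt0 ?subr_gt0.
have bd : 0 < b * (del - 1) by rewrite mulr_gt0 ?subr_gt0.
pose t1 := 1 / (b * (del - 1)).
have t1E : b * (del - 1) * t1 = 1 by rewrite /t1 mul1r mulfV// gt_eqF.
have t10 : 0 <= t1 by rewrite divr_ge0// ltW.
have t1t : t1 <= t by apply: le_trans tge; rewrite lerDr divr_ge0// ltW.
have t0 : 0 <= t := le_trans t10 t1t.
have It : I t by rewrite /I E; split => //=; exact: ltry.
have It1 : I t1 by apply: I_le It _; rewrite t10.
apply/eqP; rewrite eq_le v_ge0// andbT leNgt; apply/negP => vt.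
have vt1 : 0 < v t1 by apply: decay_positive_before It vt _; rewrite t10.
have H1 : - v t1 `^ (1 - del) + b * (del - 1) * t1 <= - v 0 `^ (1 - del) + b * (del - 1) * 0.
  apply: (@decay_first_integral (fun x => - x `^ (1 - del))
    (fun x => - ((1 - del) * x `^ (1 - del - 1))) (fun s => b * (del - 1) * s)
    (fun=> b * (del - 1)) 0 t1) => //.
  - by rewrite lexx.
  - by move=> x x0; apply: is_deriveN; exact: is_derive1_powR.
  - by move=> s _; exact: is_derive_linear.
  move=> s _ vs; rewrite E /=.
  have -> : - ((1 - del) * v s `^ (1 - del - 1)) * - (a * v s `^ gam + b * v s `^ del)
    + b * (del - 1) = - ((del - 1) * a * (v s `^ (1 - del - 1) * v s `^ gam)) +
     b * (del - 1) * (1 - v s `^ (1 - del - 1) * v s `^ del) by ring.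
  rewrite -(powRD (s := del)); last by rewrite (gt_eqF vs) implybT.
  rewrite (_ : 1 - del - 1 + del = 0) ?powRr0; last by ring.
  by rewrite subrr mulr0 addr0 oppr_le0 !mulr_ge0 ?powR_ge0 ?subr_ge0// ltW.
have v1 : v t1 <= 1.
  move: H1; rewrite mulr0 addr0 t1E => H1.
  have {}H1 : 1 <= v t1 `^ (1 - del) by have := powR_ge0 (v 0) (1 - del); lra.
  rewrite leNgt; apply/negP => v1.
  have : 1 < v t1 `^ (del - 1).
    have d1' : 0 < del - 1 by rewrite subr_gt0.
    have := @gt0_ltr_powR _ _ d1' 1 (v t1).
    by rewrite powR1 !nnegrE; apply => //; exact: ltW.
  move: H1; rewrite -opprB powRN -[1 <= _]lef_pV2 ?posrE ?invr_gt0 ?powR_gt0//.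
  by rewrite invrK invr1 leNgt => /negPf ->.
(* Now the [del] term is discarded, and the finite-time computation runs from [t1]. *)
have H2 : v t `^ (1 - gam) + a * (1 - gam) * t <= v t1 `^ (1 - gam) + a * (1 - gam) * t1.
  apply: (@decay_first_integral (fun x => x `^ (1 - gam))
    (fun x => (1 - gam) * x `^ (1 - gam - 1)) (fun s => a * (1 - gam) * s)
    (fun=> a * (1 - gam)) t1 t _ It vt (fun x x0 => is_derive1_powR _ x0)
    (fun s _ => is_derive_linear _ s)); first by rewrite t10.
  move=> s _ vs; rewrite E /=.
  have -> : (1 - gam) * v s `^ (1 - gam - 1) * - (a * v s `^ gam + b * v s `^ del)
    + a * (1 - gam) = - ((1 - gam) * b * (v s `^ (1 - gam - 1) * v s `^ del)) +
     a * (1 - gam) * (1 - v s `^ (1 - gam - 1) * v s `^ gam) by ring.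
  rewrite -(powRD (s := gam)); last by rewrite (gt_eqF vs) implybT.
  rewrite (_ : 1 - gam - 1 + gam = 0) ?powRr0; last by ring.
  by rewrite subrr mulr0 addr0 oppr_le0 !mulr_ge0 ?powR_ge0 ?subr_ge0// ltW.
have v1g : v t1 `^ (1 - gam) <= 1.
  have g1' : 0 <= 1 - gam by rewrite subr_ge0 ltW.
  have := @ge0_ler_powR _ _ g1' (v t1) 1.
  by rewrite powR1 !nnegrE; apply => //; exact: ltW.
have vtg := powR_gt0 (1 - gam) vt.
have : 1 <= a * (1 - gam) * (t - t1).
  by rewrite mulrC -ler_pdivrMr// lerBrDr.
lra.
Qed.

Lemma prescribed_time_decay mu T : law = PrescribedTime mu T ->
  forall t, 0 <= t < T -> v t <= v 0 / T `^ mu * (T - t) `^ mu.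
Proof.
move=> E t /andP[t0 tT]; have := law_ok; rewrite E /= => -[mu0 T0].
have It : I t by rewrite /I E; split => //=; rewrite lte_fin.
have [vt|vt] := leP (v t) 0.
  apply: le_trans vt _; rewrite mulr_ge0 ?powR_ge0// divr_ge0 ?powR_ge0// v_ge0//.
  by apply: I_le It _; rewrite lexx.
have v0 : 0 < v 0 by apply: decay_positive_before It vt _; rewrite lexx.
have Tt : 0 < T - t by rewrite subr_gt0.
have H : ln (v t) + - mu * ln (T - t) <= ln (v 0) + - mu * ln (T - 0).
  apply: (@decay_first_integral (@ln R) (fun x => x^-1) (fun s => - mu * ln (T - s))
    (fun s => mu / (T - s)) 0 t _ It vt (fun x x0 => is_derive1_ln x0)).
  - by rewrite lexx.
  - move=> s /andP[s0 st].
    have Ts : 0 < T - s by rewrite subr_gt0 (le_lt_trans st).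
    have dTs : is_derive s 1 (fun s => T - s) (-1).
      by apply: (is_derive_eq (is_deriveB (is_derive_cst T s 1) (is_derive_id s 1))); rewrite sub0r.
    have := is_deriveZ (- mu) 
      (@is_derive1_comp_real _ (@ln R) (fun s => T - s) s _ _ (is_derive1_ln Ts) dTs).
    by move/is_derive_eq; apply; rewrite /GRing.scale/= mulrN1 mulrNN.
  move=> s _ vs; rewrite E /=.
  by rewrite mulrN mulrCA mulVf ?gt_eqF// mulr1 addNr.
rewrite subr0 in H.
rewrite /powR !gt_eqF// -expRN -{1}(lnK (x := v t))// -{1}(lnK (x := v 0))// -!expRD ler_expR.
lra.
Qed.

Lemma decay_timing : timing law v.
Proof.
have := law_ok; case E: law => [c0|k g|a b g d|m T] /=.
- by move=> _; exact: exponential_decay.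
- move=> [k0 /andP[g0 g1]]; eexists; last by move=> t; exact: (finite_time_decay E).
  by rewrite lexx divr_ge0 ?powR_ge0// mulr_ge0 ?subr_ge0// ltW.
- move=> [a0 b0 /andP[g0 g1] d1]; eexists; last by move=> t; exact: (fixed_time_decay E).
  by rewrite lexx addr_ge0// divr_ge0// mulr_ge0 ?subr_ge0// ltW.
move=> [m0 T0].
apply: (@squeeze_cvgr _ _ _ _ (cst 0) (fun t => v 0 / T `^ m * (T - t) `^ m)).
- near=> t.
  have tT : t < T by near: t; exact: nbhs_left_lt.
  have t0 : 0 <= t by near: t; exact: nbhs_left_ge.
  rewrite (prescribed_time_decay E) ?t0// andbT v_ge0//.
  by rewrite /I E; split => //=; rewrite lte_fin.
- exact: cvg_cst.
- rewrite -[X in _ --> X](mulr0 (v 0 / T `^ m)); apply: cvgM; first exact: cvg_cst.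
  move=> A /(powR_cvg0 m0); rewrite nbhs_simpl => HA.
  (* With [e = T - t], the left limit at [T] becomes the right limit of a positive power at 0. *)
  apply/nbhs_left0P; near=> e; rewrite /= subKr.
  by near: e; exact: HA.
Unshelve. all: by end_near. Qed.

Lemma decay_cvg0 : v t @[t --> to_horizon law] --> (0 : R).
Proof.
have H := decay_timing; have := law_ok.
move: H; case E: law => [c0|k g|a b g d|m T] /=.
- move=> H c00; apply: (@squeeze_cvgr _ _ _ _ (cst 0) (fun t => v 0 * expR (- (c0 * t)))).
  + near=> t.
    have t0 : 0 <= t by near: t; apply: nbhs_pinfty_ge; exact: num_real.
    by rewrite H// andbT v_ge0// /I E; split => //=; exact: ltry.
  + exact: cvg_cst.
  + rewrite -[X in _ --> X](mulr0 (v 0)); apply: cvgM; first exact: cvg_cst.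
    apply: (@cvg_comp _ _ _ (fun t => c0 * t) (fun x => expR (- x)) _ +oo).
      by apply: gt0_cvgMry => //; exact: cvg_id.
    exact: cvgr_expR.
- move=> [t0 _ H] _; apply: cvg_near_cst.
  by apply: filterS (nbhs_pinfty_ge (num_real t0)) => t; exact: H.
- move=> [t0 _ H] _; apply: cvg_near_cst.
  by apply: filterS (nbhs_pinfty_ge (num_real t0)) => t; exact: H.
- by [].
Unshelve. all: by end_near. Qed.

End Decay.

(** * Existence of maximal trajectories *)

Section FirstOrderExpansion.
Context {R : realType} {W : normedModType R}.
Variables (z : R -> W) (t : R) (w : W).
Hypothesis t_ge0 : 0 <= t.
Hypothesis expansion : forall e, 0 < e ->
  exists2 d, 0 < d & forall s, 0 <= s -> `|s - t| < d ->
    `|z s - z t - (s - t) *: w| <= e * `|s - t|.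

(** The increment [h] may have either sign; only [0 <= t + h] restricts it, which for [t > 0] is
    automatic once [|h| < t]. *)
Let quotient_le e : 0 < e -> exists2 d, 0 < d & forall h, h != 0 -> 0 <= t + h ->
  `|h| < d -> `|w - h^-1 *: (z (t + h) - z t)| <= e.
Proof.
move=> e0; have [d d0 Hd] := expansion e0; exists d => // h h0 th hd.
have hE : t + h - t = h by rewrite addrC addKr.
have := Hd _ th; rewrite hE => /(_ hd) H.
rewrite distrC -[w in X in `|X|]scale1r -(mulVf h0) -scalerA -scalerBr normrZ normfV.
by rewrite mulrC ler_pdivrMr ?normr_gt0.
Qed.

Lemma expansion_right_derivative : right_derivative z t w.
Proof.
apply/cvgrPdist_le => e e0; have [d d0 Hd] := quotient_le e0.
near=> h.
have h0 : 0 < h by near: h; exact: nbhs_right_gt.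
apply: Hd; [by rewrite gt_eqF|by rewrite addr_ge0// ltW|].
by rewrite gtr0_norm//; near: h; exact: nbhs_right_lt.
Unshelve. all: by end_near. Qed.

Lemma expansion_is_derive : 0 < t -> is_derive t (1 : R) z w.
Proof.
move=> t0.
have H : h^-1 *: ((z \o shift t) (h *: (1 : R)) - z t) @[h --> 0^'] --> w.
  apply/cvgrPdist_le => e e0; have [d d0 Hd] := quotient_le e0.
  near=> h; rewrite /= [h *: _]mulr1 (addrC h).
  have hd : `|h| < Num.min d t.
    by near: h; apply: dnbhs0_lt; rewrite lt_min d0.
  have h0 : h != 0 by near: h; exact: nbhs_dnbhs_neq.
  move: hd; rewrite lt_min => /andP[hd ht].
  apply: Hd => //; move: ht; rewrite ltr_norml => /andP[ht _].
  by rewrite -(subrr t) lerD2l ltW.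
by apply: DeriveDef; [apply: cvgP H|exact: cvg_lim H].
Unshelve. all: by end_near. Qed.

Lemma expansion_continuous : z s @[s --> within [set s | 0 <= s] (nbhs t)] --> z t.
Proof.
apply/cvgrPdist_le => e e0; have [d d0 Hd] := expansion ltr01.
have M0 : 0 < `|w| + 1 by rewrite ltr_wpDl.
have m0 : 0 < Num.min d (e / (`|w| + 1)) by rewrite lt_min d0 divr_gt0.
have nd : \forall s \near t, `|t - s| < Num.min d (e / (`|w| + 1)).
  by apply: (@cvgr_dist_lt _ _ _ _ _ _ _ (@cvg_id _ (nbhs t)) _ m0).
near=> s.
have s0 : 0 <= s by near: s; exact: withinT.
have sd : `|t - s| < Num.min d (e / (`|w| + 1)) by near: s; exact: (cvg_within _ nd).
move: sd; rewrite lt_min distrC => /andP[sd se].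
rewrite distrC -(subrK ((s - t) *: w) (z s - z t)) (le_trans (ler_normD _ _))//.
rewrite normrZ (@le_trans _ _ (1 * `|s - t| + `|s - t| * `|w|)) ?lerD2r ?Hd//.
by move: (ltW se); rewrite ler_pdivlMr//; lra.
Unshelve. all: by end_near. Qed.

End FirstOrderExpansion.

Section Trajectories.
Context {R : realType} {N : nat}.
Variables (S : 'rV[R]_N -> 'rV[R]_N) (law : decay_law R).

(** Positivity of [x] makes the powers differentiable there; the bound on [t] keeps [T - t] away
    from 0 in the prescribed-time law. *)
Lemma sigma_cvg (x t : R) : 0 < x -> (t%:E < horizon law)%E ->
  sigma law w.1 w.2 @[w --> (x, t)] --> sigma law x t.
Proof.
move=> x0.
have c1 : w.1 @[w --> (x, t)] --> x by exact: cvg_fst.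
have c2 : w.2 @[w --> (x, t)] --> t by exact: cvg_snd.
have cp a : w.1 `^ a @[w --> (x, t)] --> x `^ a.
  have px : {for x, continuous (fun y : R => y `^ a)}.
    apply: differentiable_continuous; apply/derivable1_diffP.
    by have [] := is_derive1_powR a x0.
  exact: (@cvg_comp _ _ _ (fun w : R * R => w.1) (fun y : R => y `^ a) _ _ _ c1 px).
case: law => [c0|k g|a b g d|m T] /= tH.
- by apply: cvgM => //; exact: cvg_cst.
- by apply: cvgM => //; exact: cvg_cst.
- by apply: cvgD; apply: cvgM => //; exact: cvg_cst.
- apply: cvgM => //; apply: cvgM; first exact: cvg_cst.
  apply: cvgV; first by rewrite subr_eq0 gt_eqF.
  by apply: cvgB => //; exact: cvg_cst.
Qed.

Lemma horizon_gt0 : law_wf law -> (0 < horizon law)%E.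
Proof. by case: law => //= m T [_ T0]; rewrite lte_fin. Qed.

Lemma near_lt_ereal (tau : \bar R) (t : R) : (t%:E < tau)%E ->
  \forall s \near t, (s%:E < tau)%E.
Proof.
case: tau => [r| |]; last by rewrite ltNge leNye.
  by rewrite lte_fin => tr; apply: filterS (lt_nbhsl tr) => s; rewrite lte_fin.
by move=> _; apply: filterE => s; exact: ltry.
Qed.

(** Time intervals are open on the right, so a neighborhood of [t] within nonnegative times lies in
    the interval of the local piece, and each clause can be checked there. This glues the chains in
    Zorn's lemma. *)
Lemma trajectory_local tau z : (0 < tau <= horizon law)%E ->
  (forall t, time_interval tau t -> exists tau' z', [/\ trajectory S law tau' z',
     time_interval tau' t & forall s, time_interval tau' s -> z s = z' s]) ->
  trajectory S law tau z.
Proof.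
move=> tau0 loc; split => //.
- apply/subspace_continuousP => t It.
  have [tau' [z' [[_ cz' _ _ _] It' zz']]] := loc t It.
  have H : z' s @[s --> within (time_interval tau') (nbhs t)] --> z t.
    by rewrite zz'//; exact: (subspace_continuousP _ _).1 cz' _ It'.
  have nt := near_lt_ereal It'.2.
  move=> A /H; rewrite /fmap/= /within/= => HA.
  apply: filterS2 nt HA => s st As [s0 _].
  have Is : time_interval tau' s by split.
  by rewrite /preimage/= /from_subspace zz'//; exact: As.
- move=> t It; have [tau' [z' [[_ _ g _ _] It' zz']]] := loc t It.
  by rewrite zz'//; exact: g.
- move=> t It; have [tau' [z' [[_ _ _ d _] It' zz']]] := loc t It.
  rewrite zz'//; apply: cvg_trans (d _ It'); apply: near_eq_cvg; near=> h.
  rewrite !zz'//; have h0 : 0 < h by near: h; exact: nbhs_right_gt.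
  split; first by rewrite addr_ge0// ?(ltW h0)//; case: It.
  near: h.
  have th : t + h @[h --> 0^'+] --> t.
    rewrite -[X in _ --> X]addr0; apply: cvgD; first exact: cvg_cst.
    exact: cvg_at_right_filter cvg_id.
  exact: th (near_lt_ereal It'.2).
- move=> t It t0; have [tau' [z' [[_ _ _ _ d] It' zz']]] := loc t It.
  rewrite zz'// => Sz; apply: near_eq_is_derive (d _ It' t0 Sz).
  near=> s; rewrite zz'//; split; last by near: s; exact: near_lt_ereal It'.2.
  by apply: ltW; near: s; exact: lt_nbhsr.
Unshelve. all: by end_near. Qed.

(** Extension is only a preorder, since values outside the time interval are arbitrary; hence the
    preorder form of Zorn's lemma. *)
Lemma trajectory_extends tau z : trajectory S law tau z ->
  exists tau' z', maximal_trajectory S law tau' z' /\ z' 0 = z 0.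
Proof.
move=> tz.
pose T := {p : \bar R * (R -> 'rV[R]_N) | trajectory S law p.1 p.2 /\ p.2 0 = z 0}.
pose ext (p r : T) : Prop := ((sval p).1 <= (sval r).1)%E /\
  forall t, time_interval (sval p).1 t -> (sval r).2 t = (sval p).2 t.
have ext_refl p : ext p p by split.
have ext_trans p r s : ext p r -> ext r s -> ext p s.
  move=> [pr pr'] [rs rs']; split; first exact: le_trans rs.
  move=> t pt; rewrite rs' ?pr'//; case: pt => t0 pt; split => //.
  exact: lt_le_trans pr.
pose p0 : T := exist _ (tau, z) (conj tz erefl).
have [|||[[tau' z'] /= [tz' z'0]] max] := @ZL_preorder T p0 (fun p r => `[< ext p r >]).
- by move=> p; exact/asboolP.
- by move=> p r s /asboolP pr /asboolP rs; apply/asboolP; exact: ext_trans rs.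
- move=> A Atot.
  have [[q Aq]|A0] := pselect (A !=set0); last first.
    by exists p0 => s As; exfalso; apply: A0; exists s.
  pose tauA := ereal_sup [set (sval p).1 | p in A].
  pose inA t (p : T) := A p /\ time_interval (sval p).1 t.
  (* At each time some member of the chain defined there is chosen; members of a chain agree on
     common times, so the choice does not matter. *)
  pose zA t := if pselect (exists p, inA t p) is left e then (sval (sval (cid e))).2 t
               else z 0.
  have zAE p t : A p -> time_interval (sval p).1 t -> zA t = (sval p).2 t.
    move=> Ap pt; rewrite /zA; case: pselect => [e|]; last by case; exists p.
    case: (cid e) => r /= [Ar rt].
    by have [/asboolP[_ ->]|/asboolP[_ ->]] := Atot _ _ Ar Ap.
  have le_tauA p : A p -> ((sval p).1 <= tauA)%E.
    by move=> Ap; apply: ereal_sup_ubound; exists p.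
  have trA : trajectory S law tauA zA.
    apply: trajectory_local.
      have [[/andP[q0 _] _ _ _ _] _] := svalP q.
      apply/andP; split; first exact: lt_le_trans q0 (le_tauA _ Aq).
      apply: ge_ereal_sup => _ [p Ap <-].
      by have [[/andP[]]] := svalP p.
    move=> t [t0 /ereal_sup_gt[_ [p Ap <-] tp]].
    exists (sval p).1, (sval p).2; split => //; first by have [] := svalP p.
    by move=> s; exact: zAE.
  have zA0 : zA 0 = z 0.
    have [[/andP[q0 _] _ _ _ _] q00] := svalP q.
    by rewrite (zAE q)//; split.
  exists (exist _ (tauA, zA) (conj trA zA0)) => p Ap; apply/asboolP; split => /=.
    exact: le_tauA.
  by move=> t; exact: zAE.
exists tau', z'; split => //; split => // tau2 z2 tz2 le2 z2E.
have z20 : z2 0 = z 0.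
  by have [/andP[q0 _] _ _ _ _] := tz'; rewrite z2E//; split.
have /asboolP[/= le3 _] := max (exist _ (tau2, z2) (conj tz2 z20)) (asboolT (conj le2 z2E)).
by apply/eqP; rewrite eq_le le3.
Qed.

(** Covers the starts at which continuity of the feedback, and with it Peano's theorem, may fail. *)
Lemma equilibrium_trajectory z0 : law_wf law -> S z0 = 0 ->
  trajectory S law (horizon law) (fun=> z0).
Proof.
move=> lw S0; split.
- by rewrite horizon_gt0// lexx.
- by apply: continuous_subspaceT; exact: cst_continuous.
- by move=> t _; rewrite S0 eqxx.
- move=> t _; rewrite /feedback S0 eqxx /right_derivative.
  by under eq_fun do rewrite subrr scaler0; exact: cvg_cst.
- by move=> t _ _; rewrite S0 eqxx.
Qed.

Hypothesis S_C1 : class_C 1 S.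

Lemma feedback_continuous y t : S y != 0 -> gradS_S S y != 0 ->
  (t%:E < horizon law)%E -> {for (y, t), continuous (fun w => feedback S law w.1 w.2)}.
Proof.
move=> Sy gy tH.
have c1 : w.1 @[w --> (y, t)] --> y by exact: cvg_fst.
have c2 : w.2 @[w --> (y, t)] --> t by exact: cvg_snd.
have cV : V_of S w.1 @[w --> (y, t)] --> V_of S y.
  exact: cvg_comp c1 (@V_of_continuous _ _ _ S_C1 y).
have cG : gradS_S S w.1 @[w --> (y, t)] --> gradS_S S y.
  exact: cvg_comp c1 (@gradS_S_continuous _ _ _ S_C1 y).
(* Since V > 0 is an open condition, the case distinction in [feedback] is settled near [(y, t)] and
   the formula applies. *)
have nS : \forall w \near (y, t), S w.1 != 0.
  have Vy : 0 < V_of S y by rewrite V_of_gt0.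
  by apply: filterS (@cvgr_gt _ _ _ _ _ _ cV _ Vy) => w; rewrite V_of_gt0.
have cF : - (sigma law (V_of S w.1) w.2 / dotv (gradS_S S w.1) (gradS_S S w.1))
    *: gradS_S S w.1 @[w --> (y, t)] --> feedback S law y t.
  rewrite /feedback (negPf Sy) norm2_sqr; apply: cvgZ => //; apply: cvgN.
  apply: cvgM; last by apply: cvgV; [rewrite dotvv_eq0|exact: cvg_dotv].
  have Vy : 0 < V_of S y by rewrite V_of_gt0.
  apply: (@cvg_comp _ _ _ (fun w : 'rV[R]_N * R => (V_of S w.1, w.2))
            (fun u => sigma law u.1 u.2)); last exact: sigma_cvg Vy tH.
  exact: (cvg_pair cV c2).
apply: cvg_trans cF; apply: near_eq_cvg; apply: filterS nS => w Sw.
by rewrite /feedback (negPf Sw) norm2_sqr.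
Qed.

Lemma local_trajectory z0 : law_wf law -> S z0 != 0 -> gradS_S S z0 != 0 ->
  exists tau z, trajectory S law tau z /\ z 0 = z0.
Proof.
move=> lw S0 g0.
(* A real time bound below the possibly infinite horizon, so that the Peano radius can respect
   it. *)
have [rh rh0 rhH] : exists2 rh : R, 0 < rh & (rh%:E <= horizon law)%E.
  case: law lw => [c0 _|k g _|a b g d _|m T /= [_ T0]]; last by exists T.
  - by exists 1 => //=; exact: leey.
  - by exists 1 => //=; exact: leey.
  - by exists 1 => //=; exact: leey.
have nS : \forall y \near z0, S y != 0 /\ gradS_S S y != 0.
  have V0 : 0 < V_of S z0 by rewrite V_of_gt0.
  have n1 : \forall y \near z0, 0 < V_of S y.
    exact: (@cvgr_gt _ _ _ _ _ _ (@V_of_continuous _ _ _ S_C1 z0) _ V0).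
  have G0 : 0 < dotv (gradS_S S z0) (gradS_S S z0) by rewrite dotvv_gt0.
  have cG : gradS_S S y @[y --> z0] --> gradS_S S z0 by exact: gradS_S_continuous.
  have n2 : \forall y \near z0, 0 < dotv (gradS_S S y) (gradS_S S y).
    exact: (@cvgr_gt _ _ _ _ _ _ (cvg_dotv cG cG) _ G0).
  by apply: filterS2 n1 n2 => y; rewrite V_of_gt0 dotvv_gt0.
have /nbhs_ballP[d /= d0 Hd] := nS.
have {}Hd y : `|y - z0| < d -> S y != 0 /\ gradS_S S y != 0.
  by move=> yd; apply: Hd; rewrite -ball_normE /ball_ /= distrC.
pose r := Num.min d rh.
have r0 : 0 < r by rewrite lt_min d0.
have rd : r <= d by rewrite ge_min lexx.
have rr : r <= rh by rewrite ge_min lexx orbT.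
have [|T [z [T0 Tr z00 zr zE]]] := @Peano R N (feedback S law) z0 r r0.
  move=> y t yr tr; have [Sy gy] := Hd y (lt_le_trans yr rd).
  apply: feedback_continuous => //; apply: lt_le_trans rhH; rewrite lte_fin.
  exact: le_lt_trans (ler_norm _) (lt_le_trans tr rr).
have zN t : time_interval T%:E t -> S (z t) != 0 /\ gradS_S S (z t) != 0.
  by move=> [t0 tT]; apply/Hd/(lt_le_trans _ rd)/zr; rewrite t0 -lte_fin.
exists T%:E, z; split; last exact: z00.
split.
- by rewrite lte_fin T0 (le_trans _ rhH)// lee_fin (le_trans Tr).
- apply/subspace_continuousP => t It.
  have tT : 0 <= t < T by case: It => t0; rewrite lte_fin t0.
  apply: cvg_trans (expansion_continuous (zE t tT)).
  apply: cvg_app; apply: within_subset; by [move=> s []].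
- by move=> t /zN[].
- move=> t [t0 tT]; apply: expansion_right_derivative => //.
  by apply: zE; rewrite t0 -lte_fin.
- move=> t [t0 tT] tp _; apply: expansion_is_derive => //.
  by apply: zE; rewrite t0 -lte_fin.
Qed.

(** Dividing by the squared norm in the feedback cancels the pairing of the gradient with itself,
    leaving exactly the decay rate. *)
Lemma derive_V_of_feedback z t : S z != 0 -> gradS_S S z != 0 ->
  'D_(feedback S law z t) (V_of S) z = - sigma law (V_of S z) t.
Proof.
move=> Sz gz; rewrite derive_V_of// /feedback (negPf Sz) dotvZl norm2_sqr mulNr divfK//.
by rewrite dotvv_eq0.
Qed.

(** Each component of [S] is at most the square root of [2 * V] in absolute value. *)
Lemma cvg_zero_of_V_of (T : Type) (F : set_system T) {FF : Filter F} (z : T -> 'rV[R]_N) :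
  V_of S (z t) @[t --> F] --> (0 : R) -> S (z t) @[t --> F] --> (0 : 'rV[R]_N).
Proof.
move=> v0; apply: cvg_row => j; rewrite mxE.
have s0 : Num.sqrt (2 * V_of S (z t)) @[t --> F] --> (0 : R).
  rewrite -[X in _ --> X](sqrtr0 R) -[in X in _ --> X](mulr0 (2 : R)).
  apply: (@cvg_comp _ _ _ (fun t => 2 * V_of S (z t)) Num.sqrt _ _ _ _ (@sqrt_continuous _ _)).
  by apply: cvgM => //; exact: cvg_cst.
apply: (@squeeze_cvgr _ _ _ _ (fun t => - Num.sqrt (2 * V_of S (z t)))
                              (fun t => Num.sqrt (2 * V_of S (z t)))) => //.
  apply: filterE => t; rewrite -ler_norml -sqrtr_sqr ler_wsqrtr//.
  by rewrite V_ofE mulrA mulfV// mul1r sqr_entry_le_dotvv.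
by rewrite -[X in _ --> X]oppr0; exact: cvgN.
Qed.

End Trajectories.

#[local] Instance to_horizon_filter (R : realType) (law : decay_law R) :
  ProperFilter (to_horizon law).
Proof. by case: law => * /=; apply: _. Qed.

(** The existence clause keeps the second one from being vacuous. Uniqueness is not claimed, so the
    conclusions are stated for every maximal trajectory from [z0]. *)
Theorem mainTheorem4 (R : realType) (n p q : nat)
  (J : 'rV[R]_n -> R) (g : 'rV[R]_n -> 'rV[R]_p) (h : 'rV[R]_n -> 'rV[R]_q)
  (J_C2 : class_C 2 J) (g_C2 : class_C 2 g) (h_C2 : class_C 2 h)
  (opt_finite : finite_optimal_value J g h)
  (eps : R) (eps_gt0 : 0 < eps)
  (xs : 'rV[R]_n) (lams : 'rV[R]_p) (mus : 'rV[R]_q)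
  (kkt : KKT_point J g h xs lams mus) (licq : LICQ g h xs)
  (U : set 'rV[R]_(n + p + q)) (U_open : open U)
  (U_KKT : U (row_mx (row_mx xs lams) mus))
  (U_regular : OLF_regular (stationarity J g h eps) U)
  (U_Lojasiewicz : Lojasiewicz (stationarity J g h eps) U)
  (zeps : 'rV[R]_(n + p + q))
  (U_zero : zero_set (stationarity J g h eps) `&` U = [set zeps])
  (law : decay_law R) (law_ok : law_wf law)
  (rho : R) (rho_gt0 : 0 < rho)
  (rho_threshold : forall c' : R, 0 < c' <= rho ->
     closed_in U (sublevel (stationarity J g h eps) U c') /\
     forward_invariant (stationarity J g h eps) law
       (sublevel (stationarity J g h eps) U c'))
  (c : R) (c_range : 0 < c <= rho)
  (z0 : 'rV[R]_(n + p + q)) (z0_in : sublevel (stationarity J g h eps) U c z0) :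
  (exists tau z,
     maximal_trajectory (stationarity J g h eps) law tau z /\ z 0 = z0) /\
  (forall tau z,
     maximal_trajectory (stationarity J g h eps) law tau z -> z 0 = z0 ->
     let v t := V_of (stationarity J g h eps) (z t) in
     [/\ tau = horizon law,
         forall t, time_interval (horizon law) t ->
           sublevel (stationarity J g h eps) U c (z t),
         forall t, time_interval (horizon law) t -> 0 < v t ->
           right_derivative v t (- sigma law (v t) t) /\
           (0 < t -> is_derive t (1 : R) v (- sigma law (v t) t)),
         stationarity J g h eps (z t) @[t --> to_horizon law]
           --> (0 : 'rV[R]_(n + p + q))
       & timing law v]).
Proof.
have := stationarity_C1 J_C2 g_C2 h_C2 eps_gt0.
set S := stationarity J g h eps in U_regular rho_threshold z0_in *.
move=> S_C1; split.
  have [S0|S0] := eqVneq (S z0) 0.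
    have tz := equilibrium_trajectory law_ok S0.
    by have [tau [z [mz zz0]]] := trajectory_extends tz; exists tau, z.
  (* Regularity (a) enters here: it makes the feedback formula meaningful at the start. *)
  have g0 : gradS_S S z0 != 0.
    by rewrite -grad_V_of// U_regular//; [case: z0_in|rewrite gt_eqF// V_of_gt0].
  have [tau1 [z1 [tz1 z10]]] := local_trajectory S_C1 law_ok S0 g0.
  have [tau [z [mz zz0]]] := trajectory_extends tz1.
  by exists tau, z; rewrite zz0.
move=> tau z mz zz0 v.
(* The threshold assumption is used at the level [c] itself and yields both completeness and
   invariance. *)
have [tauE inv] : tau = horizon law /\
    forall t, time_interval (horizon law) t -> sublevel S U c (z t).
  by have [_ fi] := rho_threshold c c_range; apply: fi mz _; rewrite zz0.
have [[_ cz gz rz dz] _] := mz; rewrite tauE in cz gz rz dz.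
have dV y : differentiable (V_of S) y by exact: (V_of_C1 S_C1).1.
have dv t : time_interval (horizon law) t -> 0 < v t ->
    right_derivative v t (- sigma law (v t) t) /\
    (0 < t -> is_derive t (1 : R) v (- sigma law (v t) t)).
  move=> It; rewrite V_of_gt0 => Sz; rewrite -derive_V_of_feedback//; last exact: gz.
  split; first by apply: right_derivative_comp => //; exact: rz.
  by move=> t0; apply: is_derive_comp => //; exact: dz.
have v_ge0 t : time_interval (horizon law) t -> 0 <= v t by move=> _; exact: V_of_ge0.
have v_cont : {within time_interval (horizon law), continuous v}.
  apply/subspace_continuousP => t It.
  exact: cvg_comp ((subspace_continuousP _ _).1 cz t It) (@V_of_continuous _ _ _ S_C1 (z t)).
have v_derive t : time_interval (horizon law) t -> 0 < t -> 0 < v t ->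
    is_derive t (1 : R) v (- sigma law (v t) t).
  by move=> It t0 vt; have [_] := dv t It vt; apply.
split => //.
  by apply: cvg_zero_of_V_of; exact: (decay_cvg0 law_ok v_ge0 v_cont v_derive).
exact: (decay_timing law_ok v_ge0 v_cont v_derive).
Qed.
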